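(* Let $(X,0)\subset(\mathbb{C}^m,0)$ be the germ of a reduced complex analytic set, and let $f: X\to\mathbb{C}$ be an analytic function which is a submersion on a Zariski open and dense subset of $X$. Let $\tilde f$ be an extension of $f$ to the ambient space. Then for each point $x\in X$ there is a set-theoretic equality $$C(X,f)_x=(\pi(E_{\tilde f}))_x\ \cup\ d\tilde f(x)*C(X)_x .$$
   Context: All germs are replaced by suitably small representatives; $U\subset\mathbb{C}^m$ is an open set containing a representative of $X$. A subscript $x$ denotes the fiber over the point $x\in X$, regarded as a subset of $\mathbb{P}^{m-1}$ (the projectivized dual space of $\mathbb{C}^m$). Conormal space: $T^*_XU$ is the closure in $\mathbb{C}^m\times{\mathbb{C}^m}^*$ of the set of pairs $(x,\eta)$ with $x$ a smooth point of $X$ and $\eta$ a covector vanishing on $T_xX$. $C(X)\subset X\times\mathbb{P}^{m-1}$ is its projectivization, i.e. the closure of the set of $(x,H)$ with $x$ a smooth point of $X$ and $H$ a hyperplane tangent to $X$ at $x$ (containing $T_xX$). Relative conormal space: $T^*_fU$ is the closure in $X\times{\mathbb{C}^m}^*$ of the set of $(x,\eta)$ with $x$ a smooth point of $X$ and $\eta(T_xX\cap\ker d\tilde f(x))=0$. $C(X,f)\subset X\times\mathbb{P}^{m-1}$ is the projectivization of $T^*_fU$ (the closure of the set of tangent hyperplanes to level sets of $f$ at their smooth points). It does not depend on the choice of $\tilde f$. Blowup: let $z_1,\dots,z_m$ be coordinates on $U$ and $w_1,\dots,w_m$ the cotangent coordinates. $\mathrm{Bl}_{\mathrm{im}\,d\tilde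 f}T^*_XU\subset X\times{\mathbb{C}^m}^*\times\mathbb{P}^{m-1}$ is the blowup of $T^*_XU$ along the ideal $(w_1-\partial\tilde f/\partial z_1,\dots,w_m-\partial\tilde f/\partial z_m)$, with exceptional divisor $E_{\tilde f}$. The map $\pi: X\times{\mathbb{C}^m}^*\times\mathbb{P}^{m-1}\to X\times\mathbb{P}^{m-1}$ is the projection. The set $\pi(E_{\tilde f})$ does not depend on the choice of $\tilde f$. Join: for a point $a\in\mathbb{P}^{m-1}$ and a subset $V\subset\mathbb{P}^{m-1}$ distinct from the point $a$, the join $a*V$ is the set of points on all lines joining $a$ and the points of $V$; if $a\in V$ and $V\neq\{a\}$, one takes the join of $a$ and $V\setminus\{a\}$ and then the closure of this set. If $V=\{a\}$ there are no such lines, and the join contributes no points. Let $m_{X,x}$ be the maximal ideal of $\mathcal{O}_{X,x}$. If $f-f(x)\notin m_{X,x}^2$, then $d\tilde f(x)*C(X)_x$ denotes the join of $C(X)_x$ with the point $\langle d\tilde f(x)\rangle\in\mathbb{P}^{m-1}$ determined by $d\tilde f(x)$ (this is independent of the choice of $\tilde f$). If $f-f(x)\in m_{X,x}^2$, then by convention $d\tilde f(x)*C(X)_x$ is empty.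
   Formalization: The join of a point a with the empty set is taken to be {a} rather than empty; this matters where C(X)_x is empty (X open near x), where the literal equality fails, e.g. for X = C^m and f = z_1. *)

(* Defs.v *)
From HB Require Import structures.
From mathcomp Require Import all_boot all_order all_algebra generic_quotient.
From mathcomp Require Import complex.
From mathcomp Require Import all_classical all_reals all_analysis.
Import Order.TTheory GRing.Theory Num.Theory.
Import numFieldNormedType.Exports.

Set Implicit Arguments.
Unset Strict Implicit.
Unset Printing Implicit Defensive.

Local Open Scope classical_set_scope.
Local Open Scope ring_scope.
Local Open Scope quotient_scope.

(* The complex numbers, packed as a numClosedFieldType: the library's topology
   and norm are attached to the carrier of such a structure, not to R[i]. *)
Definition Cplx (R : realType) : numClosedFieldType := R[i]%C.

(* A point (z_1, ..., z_m) of C^m and a covector w_1 dz_1 + ... + w_m dz_m are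
   both represented by the row vector of their coordinates. *)

Section Projective_space.
Variables (R : realType) (m : nat).
Local Notation C := (Cplx R).
Local Notation V := ('rV[C]_m).

Definition nonzero : set V := [set v | v != 0].

Definition proportional (u v : nonzero) : bool :=
  `[< exists c : C, c != 0 /\ val u = c *: val v >].

Lemma proportional_refl : reflexive proportional.
Proof. by move=> u; apply/asboolP; exists 1; rewrite oner_neq0 scale1r. Qed.

Lemma proportional_sym : symmetric proportional.
Proof.
suff h u v : proportional u v -> proportional v u.
  by move=> u v; apply/idP/idP; exact: h.
move=> /asboolP[c [c0 e]]; apply/asboolP; exists c^-1.
by rewrite invr_neq0// e scalerA mulVf// scale1r.
Qed.

Lemma proportional_trans : transitive proportional.
Proof.
move=> v u w /asboolP[c [c0 e]] /asboolP[d [d0 e']]; apply/asboolP.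
by exists (c * d); rewrite mulf_neq0// e e' scalerA.
Qed.

Canonical proportional_equiv :=
  EquivRel proportional proportional_refl proportional_sym proportional_trans.

(* P^(m-1), with the quotient of the subspace topology on C^m \ {0}. *)
Definition Pspace : topologicalType :=
  quotient_topology {eq_quot proportional_equiv}.

Definition pclass (u : nonzero) : Pspace :=
  \pi_(quotient_topology {eq_quot proportional_equiv}) u.

(* v is nonzero and a is the point <v> of P^(m-1). *)
Definition is_pclass (v : V) (a : Pspace) : Prop :=
  exists u : nonzero, val u = v /\ pclass u = a.

(* This is the line through a and b only for a <> b. *)
Definition pline (a b : Pspace) : set Pspace :=
  [set c | exists u v w : V, [/\ is_pclass u a, is_pclass v b, is_pclass w c &
                              exists s t : C, w = s *: u + t *: v]].

Definition plines (a : Pspace) (W : set Pspace) : set Pspace :=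
  [set c | exists2 b, W b & pline a b c].

(* The join a * W.  If a is not in W and W is nonempty, then a already lies on
   the lines [plines a W], so the union with [set a] only matters for W = set0,
   where it gives the usual convention a * set0 = {a}.  If W = {a} the join is
   empty. *)
Definition join (a : Pspace) (W : set Pspace) : set Pspace :=
  [set c | (W a /\ closure (plines a (W `\ a)) c) \/
           (~ W a /\ (c = a \/ plines a W c))].

(* The projectivization of a conic subset of C^m x (C^m)^*. *)
Definition projectivization (T : set (V * V)) : set (V * Pspace) :=
  [set p | exists2 w, T (p.1, w) & is_pclass w p.2].

Definition fiber (S : set (V * Pspace)) (x : V) : set Pspace :=
  [set a | S (x, a)].

(* Blowup of Y along the ideal generated by the components of h: the closure
   in Y x P^(m-1) of the graph of y |-> <h y>, defined off the zeros of h. *)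
Definition blowup (T : topologicalType) (Y : set T) (h : T -> V) :
    set (T * Pspace) :=
  [set q | Y q.1] `&` closure [set q | Y q.1 /\ is_pclass (h q.1) q.2].

Definition exceptional_divisor (T : topologicalType) (Y : set T) (h : T -> V) :
    set (T * Pspace) :=
  blowup Y h `&` [set q | h q.1 = 0].

End Projective_space.

Section Analytic_sets.
Variables (R : realType) (m : nat).
Local Notation C := (Cplx R).
Local Notation V := ('rV[C]_m).

(* f is, on a polydisc centered at p, the sum of an absolutely convergent power
   series; the partial sums are taken over the multi-indices in [0, n[^m. *)
Definition analytic_at (f : V -> C) (p : V) : Prop :=
  exists (c : ('I_m -> nat) -> C) (r M : C),
  [/\ 0 < r,
      forall n : nat, \sum_(a : {ffun 'I_m -> 'I_n})
        `|c (fun i => a i : nat)| * r ^+ (\sum_i (a i : nat))%N <= M &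
      forall z : V, (forall i, `|z 0 i| < r) ->
        (fun n : nat => \sum_(a : {ffun 'I_m -> 'I_n})
           c (fun i => a i : nat) * \prod_i z 0 i ^+ a i : C) @ \oo
        --> f (p + z)].

(* X is locally the common zero set of finitely many analytic functions. *)
Definition analytic_subset (U X : set V) : Prop :=
  X `<=` U /\
  forall p, U p -> exists (k : nat) (g : 'I_k -> V -> C),
    (forall i, analytic_at (g i) p) /\
    \forall y \near p, X y <-> forall i, g i y = 0.

(* An analytic function on X: locally the restriction of an ambient one; the
   values of f outside X are irrelevant. *)
Definition analytic_on_set (X : set V) (f : V -> C) : Prop :=
  forall p, X p -> exists2 g, analytic_at g p &
    \forall y \near p, X y -> f y = g y.

Definition pairing (w v : V) : C := \sum_i w 0 i * v 0 i.

(* The differential of f at x, as the covector of its partial derivatives. *)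
Definition grad (f : V -> C) (x : V) : V :=
  \row_i ('D_(delta_mx 0 i : V) f x : C).

(* X is a complex submanifold near x, by the Jacobian criterion. *)
Definition smooth_point (X : set V) (x : V) : Prop :=
  X x /\ exists (k : nat) (g : 'I_k -> V -> C),
    [/\ forall i, analytic_at (g i) x,
        row_free (\matrix_(i < k, j < m) grad (g i) x 0 j) &
        \forall y \near x, X y <-> forall i, g i y = 0].

(* T_xX: the vectors killed by the differentials at x of all the germs of
   analytic functions vanishing on X. *)
Definition tangent (X : set V) (x : V) : set V :=
  [set v | forall g, analytic_at g x -> (\forall y \near x, X y -> g y = 0) ->
           pairing (grad g x) v = 0].

(* The germ at x of g restricted to X lies in the square of the maximal ideal
   of O_{X,x}, the ring of restrictions to X of ambient analytic germs. *)
Definition in_max_ideal_sq (X : set V) (x : V) (g : V -> C) : Prop :=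
  exists (k : nat) (a b : 'I_k -> V -> C),
    (forall i, [/\ analytic_at (a i) x, analytic_at (b i) x,
                   a i x = 0 & b i x = 0]) /\
    \forall y \near x, X y -> g y = \sum_i a i y * b i y.

(* f, with extension ft, is a submersion on the complement in X of an analytic
   subset Z of U, and this complement is dense in X. *)
Definition generic_submersion (U X : set V) (ft : V -> C) : Prop :=
  exists Z : set V,
    [/\ analytic_subset U Z, Z `<=` X, X `<=` closure (X `\` Z) &
        forall x, (X `\` Z) x -> smooth_point X x /\
          exists2 v, tangent X x v & pairing (grad ft x) v != 0].

(* T^*_X U.  As X is closed in U, cutting the closure down to points of X gives
   the closure in U x (C^m)^*. *)
Definition conormal (X : set V) : set (V * V) :=
  [set p | X p.1] `&`
  closure [set p | smooth_point X p.1 /\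
                   forall v, tangent X p.1 v -> pairing p.2 v = 0].

Definition relative_conormal (X : set V) (ft : V -> C) : set (V * V) :=
  [set p | X p.1] `&`
  closure [set p | smooth_point X p.1 /\
                   forall v, tangent X p.1 v -> pairing (grad ft p.1) v = 0 ->
                             pairing p.2 v = 0].

Definition proj_conormal (X : set V) := projectivization (conormal X).

Definition proj_relative_conormal (X : set V) (ft : V -> C) :=
  projectivization (relative_conormal X ft).

(* E_ft, for the ideal (w_1 - d ft/d z_1, ..., w_m - d ft/d z_m) on T^*_X U. *)
Definition E_div (X : set V) (ft : V -> C) : set (V * V * Pspace R m) :=
  exceptional_divisor (conormal X) (fun p : V * V => p.2 - grad ft p.1).

Definition proj_out (q : V * V * Pspace R m) : V * Pspace R m := (q.1.1, q.2).

(* d ft(x) * C(X)_x.  By Hadamard's lemma d ft(x) <> 0 as soon as f - f(x) is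
   not in the square of the maximal ideal, so the point <d ft(x)> exists. *)
Definition join_term (X : set V) (f ft : V -> C) (x : V) : set (Pspace R m) :=
  [set c | ~ in_max_ideal_sq X x (fun y => f y - f x) /\
           exists2 a, is_pclass (grad ft x) a &
                      join a (fiber (proj_conormal X) x) c].

End Analytic_sets.

(* Main.v *)
Require Import Defs.
From mathcomp Require Import all_boot all_order all_algebra generic_quotient.
From mathcomp Require Import complex ring spectral sesquilinear.
From mathcomp Require Import all_classical all_reals all_analysis.
Import Order.TTheory GRing.Theory Num.Theory.
Import numFieldNormedType.Exports.

(* At a smooth point y, a covector killing the kernel of df(y) on T_yX has the
   form w + t df(y) with w conormal, by linear algebra.  Let w_n + t_n df(y_n)
   tend to eta.  If t_n is unbounded, then -w_n/t_n tends to df(x) and the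
   direction of -w_n/t_n - df(y_n) tends to <eta>, so <eta> is in pi(E).  If t_n
   is bounded, a subsequence gives eta = w + t df(x) with (x, w) conormal, hence
   a point of the join when f - f(x) is not in m^2, except for <df(x)> when
   C(X)_x = {<df(x)>}; this point is the direction of (1 + s) df(x) - df(x) and
   lies in pi(E).  If f - f(x) is in m^2, then every (x, w + s df(x)) is
   conormal, so <eta> is in pi(E): near x, f is Lipschitz on X with an
   arbitrarily small constant, so df(y) is almost conormal at smooth points y
   close to x.  This needs points of X close to y in any direction killed by the
   Jacobian, which come from a contraction; strict differentiability is the only
   consequence of analyticity that is used. *)

Set Implicit Arguments.
Unset Strict Implicit.
Unset Printing Implicit Defensive.

Local Open Scope classical_set_scope.
Local Open Scope ring_scope.

(* Otherwise simplification unfolds the packed structure of C. *)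
Local Arguments Cplx : simpl never.

(** * The sup norm of row vectors *)

Section RowNorm.
Variable K : numFieldType.

(** The order of [K] is only partial, but positive elements are real, hence comparable. Smallness
    conditions on a constant are combined in this way below. *)
Lemma pos_min2 (x y : K) : 0 < x -> 0 < y ->
  exists z, [/\ 0 < z, z <= x & z <= y].
Proof.
move=> x0 y0; have [xy|yx] := real_leP (gtr0_real x0) (gtr0_real y0).
  by exists x.
by exists y; split=> //; exact: ltW.
Qed.

Lemma rV_norm_leP n (v : 'rV[K]_n) (e : K) : 0 <= e ->
  (`|v| <= e) <-> (forall i, `|v 0 i| <= e).
Proof.
move=> /nonnegP[{}e].
rewrite (_ : `|v| = mx_norm v)// mx_normE num_le; split.
  by move=> /bigmax_leP[_ h] i; have := h (0, i) isT; rewrite -num_le.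
move=> h; apply/bigmax_leP; split=> [|[i j] _].
  by rewrite -num_le/=.
by rewrite -num_le/= ord1; exact: h.
Qed.

Lemma rV_entry_le n (v : 'rV[K]_n) i : `|v 0 i| <= `|v|.
Proof. exact: (rV_norm_leP v (normr_ge0 v)).1. Qed.

Lemma mulmx_bounded m n (A : 'M[K]_(m, n)) :
  exists2 c, 0 < c & forall v : 'rV_m, `|v *m A| <= c * `|v|.
Proof.
pose c := \sum_i \sum_j `|A i j|.
have c0 : 0 <= c by apply: sumr_ge0 => i _; exact: sumr_ge0.
(* Adding 1 keeps the constant positive when [A] is zero. *)
exists (c + 1); first by rewrite ltr_wpDl.
move=> v; apply/rV_norm_leP => [|j].
  by rewrite mulr_ge0// addr_ge0.
rewrite mxE (le_trans (ler_norm_sum _ _ _))//.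
rewrite mulrDl mul1r (@le_trans _ _ (c * `|v|))// ?lerDl// /c mulr_suml.
apply: ler_sum => i _; rewrite normrM mulrC ler_pM// ?rV_entry_le//.
by rewrite (bigD1 j)//= lerDl sumr_ge0.
Qed.

End RowNorm.

(** * Compactness and fixed points over C *)

Section Compactness.
Variable R : realType.
Local Notation C := (Cplx R).

Lemma Cplx_real_ge0 (x : C) : 0 <= x -> exists2 a : R, 0 <= a & x = a%:C%C.
Proof. by case: x => a b; rewrite lecE /= => /andP[/eqP -> a0]; exists a. Qed.

Lemma Cplx_ReK (x : C) : 0 <= x -> (complex.Re x)%:C%C = x.
Proof. by move=> /Cplx_real_ge0[a _ ->]. Qed.

Lemma norm_real_complex (a : R) : `|a%:C%C : C| = `|a|%:C%C.
Proof. by rewrite [LHS](normc_def (a%:C)%C)/= expr0n addr0 sqrtr_sqr. Qed.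

Lemma real_complex_continuous : continuous (fun a : R => a%:C%C : C).
Proof.
move=> a; apply/cvgrPdist_lt => /= e e0.
have [r r0 er] := Cplx_real_ge0 (ltW e0).
have {}r0 : 0 < r by move: e0; rewrite er ltcR.
near=> b; rewrite -rmorphB norm_real_complex er ltcR.
near: b; apply: cvgr_dist_lt => //; exact: cvg_id.
Unshelve. all: by end_near. Qed.

Lemma Re_continuous : continuous (fun z : C => complex.Re z).
Proof.
move=> z; apply/(@cvgrPdist_lt _ _ _ (nbhs z) (nbhs_filter z)) => e e0.
apply/nbhs_ballP; exists (e%:C)%C; first by rewrite /= ltcR.
move=> w; rewrite -ball_normE => zw; rewrite -ltcR; apply: le_lt_trans zw.
by rewrite -raddfB; exact: normc_ge_Re.
Qed.

(** The disc is a closed subset of the continuous image of a compact square of real and imaginary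
    parts. *)
Lemma closed_disc_compact (M : C) : compact [set t : C | `|t| <= M].
Proof.
have [M0|M0] := boolP (0 <= M); last first.
  rewrite (_ : [set _ | _] = set0); first exact: compact0.
  by apply/seteqP; split=> // t /= tM; rewrite (le_trans _ tM) in M0.
have [r r0 Mr] := Cplx_real_ge0 M0.
pose f (p : R * R) : C := (p.1)%:C%C + 'i%C * (p.2)%:C%C.
have cf : continuous f.
  move=> p; apply: cvgD; first apply: (continuous_comp cvg_fst).
    exact: real_complex_continuous.
  apply: cvgM; first exact: cvg_cst.
  by apply: (continuous_comp cvg_snd); exact: real_complex_continuous.
pose S := `[- r, r]%classic : set R.
have cS : compact (f @` (S `*` S)).
  apply: continuous_compact.
    exact: continuous_subspaceT.
  by apply: compact_setX; exact: segment_compact.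
apply: subclosed_compact cS _.
  (* The norm takes values in [C]; its real part is used so that the closedness of a half-line of
     [R] applies. *)
  rewrite (_ : [set _ | _] = 
      (fun t : C => complex.Re (`|t| : C)) @^-1` [set a | a <= r]).
    apply: closed_comp (@closed_le _ r) => t _.
    apply: (@continuous_comp _ _ _ (fun t : C => `|t|)).
      exact: norm_continuous.
    exact: Re_continuous.
  by apply/seteqP; split=> t; rewrite /preimage /mkset -lecR -Mr Cplx_ReK.
move=> t /= tM; exists (complex.Re t, complex.Im t); last first.
  by rewrite /f/= -complexE.
rewrite /S /=; split; rewrite /= in_itv/= -ler_norml -lecR -Mr.
  exact: (le_trans (normc_ge_Re t)).
have -> : complex.Im t = - complex.Re (t * 'i%C) by rewrite ReiNIm opprK.
rewrite normrN; apply: (le_trans (normc_ge_Re _)).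
by rewrite normrM [`|'i%C|]normc_def/= expr0n add0r expr1n sqrtr1 mulr1.
Qed.

Lemma closed_ball_rV_compact n (M : C) : compact [set u : 'rV[C]_n | `|u| <= M].
Proof.
have [M0|M0] := boolP (0 <= M); last first.
  rewrite (_ : [set _ | _] = set0); first exact: compact0.
  by apply/seteqP; split=> // t /= tM; rewrite (le_trans _ tM) in M0.
rewrite (_ : [set _ | _] = [set u : 'rV[C]_n | forall i, `|u ord0 i| <= M]).
  exact: (@rV_compact C n (fun=> [set t : C | `|t| <= M])
    (fun=> @closed_disc_compact M)).
by apply/seteqP; split=> u /= /(rV_norm_leP u M0).
Qed.

(* A minimum of |psi u - u| on the ball is a fixed point, so no completeness of
   C is needed. *)
Lemma contraction_ball_fixpoint n (M : C) (psi : 'rV[C]_n -> 'rV[C]_n) :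
  0 <= M ->
  (forall u, `|u| <= M -> `|psi u| <= M) ->
  (forall u v, `|u| <= M -> `|v| <= M -> `|psi u - psi v| <= 2^-1 * `|u - v|) ->
  exists2 u, `|u| <= M & psi u = u.
Proof.
move=> M0 stab contr; pose B := [set u : 'rV[C]_n | `|u| <= M].
pose h (u : 'rV[C]_n) : R := complex.Re (`|psi u - u| : C).
have hE (u : 'rV[C]_n) : `|psi u - u| = (h u)%:C%C by rewrite Cplx_ReK.
(* The contraction and the identity contribute at most one [|u - v|] each. *)
have hlip u v : B u -> B v -> `|(h u - h v)%:C%C : C| <= 2 * `|u - v|.
  move=> Bu Bv; rewrite rmorphB /= -!hE (le_trans (ler_dist_dist _ _))//.
  rewrite (_ : _ - _ = (psi u - psi v) - (u - v)); last first.
    by rewrite !opprD !opprK addrACA.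
  rewrite (le_trans (ler_normB _ _))// (_ : 2 = 1 + 1 :> C)// mulrDl mul1r.
  rewrite lerD2r (le_trans (contr _ _ Bu Bv))// ler_piMl//.
  by rewrite invf_le1// ler1n.
have ch : {within B, continuous h}.
  apply/subspace_continuousP => u Bu; apply/cvgrPdist_lt => e e0.
  have e20 : 0 < (e / 2)%:C%C :> C by rewrite ltcR divr_gt0.
  rewrite near_withinE; apply/nbhs_ballP; exists (e / 2)%:C%C => //.
  move=> v; rewrite -ball_normE /= => uv Bv.
  rewrite -ltcR -norm_real_complex (le_lt_trans (hlip u v Bu Bv))//.
  rewrite -ltr_pdivlMl// (lt_le_trans uv)//.
  by rewrite rmorphM fmorphV rmorphMn /= mulrC.
have B0 : B !=set0 by exists 0; rewrite /B/= normr0.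
have [u /set_mem Bu umin] :=
  compact_EVT_min B0 (@closed_ball_rV_compact n M) ch.
exists u => //; apply/eqP; rewrite -subr_eq0 -normr_le0.
(* Applying [psi] at least halves the displacement [|psi u - u|], while minimality forbids any
   decrease; so it is zero. *)
have := umin (psi u) (mem_set (stab _ Bu)).
rewrite -lecR -!hE => /le_trans/(_ (contr _ _ (stab _ Bu) Bu)).
rewrite -subr_le0 -{1}[`|_|]mul1r -mulrBl pmulr_rle0//.
suff -> : 1 - 2^-1 = 2^-1 :> C by rewrite ?invr_gt0.
by rewrite {1}(splitr (1 : C)) div1r addrK.
Qed.

End Compactness.

(** * Zeros near tangent vectors *)

Section StrictDiff.
Variables (R : realType).
Local Notation C := (Cplx R).

(** The inverse of 1 plus the sum of the inverses is a common lower bound; the 1 covers the empty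
    family. *)
Lemma pos_min_ord k (d : 'I_k -> C) : (forall i, 0 < d i) ->
  exists2 e, 0 < e & forall i, e <= d i.
Proof.
move=> d0; have S0 : 0 <= \sum_i (d i)^-1.
  by apply: sumr_ge0 => i _; rewrite invr_ge0 ltW.
exists (1 + \sum_i (d i)^-1)^-1; first by rewrite invr_gt0 ltr_wpDr.
move=> i; rewrite invf_ple ?posrE ?ltr_wpDr//.
rewrite (bigD1 i)//= addrCA lerDl addr_ge0//.
by apply: sumr_ge0 => j _; rewrite invr_ge0 ltW.
Qed.

Section pairing.
Variable m : nat.
Implicit Types u v w : 'rV[C]_m.

Lemma pairingDl u v w : pairing (u + v) w = pairing u w + pairing v w.
Proof. by rewrite -big_split/=; apply: eq_bigr => i _; rewrite mxE mulrDl. Qed.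

Lemma pairingZl a v w : pairing (a *: v) w = a * pairing v w.
Proof. by rewrite mulr_sumr; apply: eq_bigr => i _; rewrite mxE mulrA. Qed.

Lemma pairingC v w : pairing v w = pairing w v.
Proof. by apply: eq_bigr => i _; rewrite mulrC. Qed.

Lemma pairingZr a v w : pairing v (a *: w) = a * pairing v w.
Proof. by rewrite !(pairingC v) pairingZl. Qed.

Lemma pairingNl v w : pairing (- v) w = - pairing v w.
Proof. by rewrite -scaleN1r pairingZl mulN1r. Qed.

Lemma pairingBl u v w : pairing (u - v) w = pairing u w - pairing v w.
Proof. by rewrite pairingDl pairingNl. Qed.

Lemma pairingBr u v w : pairing u (v - w) = pairing u v - pairing u w.
Proof. by rewrite !(pairingC u) pairingBl. Qed.

Lemma pairing_delta v i : pairing v (delta_mx 0 i) = v 0 i.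
Proof.
rewrite /pairing (bigD1 i)//= big1 => [|j ji].
  by rewrite !mxE !eqxx mulr1 addr0.
by rewrite !mxE (negbTE ji) andbF mulr0.
Qed.

Lemma pairing_bounded v : 
  exists2 c, 0 < c & forall w, `|pairing v w| <= c * `|w|.
Proof.
have [c c0 hc] := mulmx_bounded v^T; exists c => // w.
rewrite (le_trans _ (hc w))// (_ : pairing v w = (w *m v^T) 0 0) ?rV_entry_le//.
by rewrite !mxE; apply: eq_bigr => i _; rewrite mxE mulrC.
Qed.

End pairing.

Section implicit.
Variables (m k : nat) (G : 'rV[C]_m -> 'rV[C]_k) (y : 'rV[C]_m).
Variables (J : 'M[C]_(m, k)) (K : 'M[C]_(k, m)).
Hypothesis KJ : K *m J = 1%:M.
Hypothesis Gy : G y = 0.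
Hypothesis GJ : forall e : C, 0 < e -> exists2 d : C, 0 < d &
  forall z z' : 'rV[C]_m, `|z - y| < d -> `|z' - y| < d ->
    `|G z - G z' - (z - z') *m J| <= e * `|z - z'|.

(** The zero is sought in the form [y + s *: v + u *m K]. Since [K *m J = 1], strict
    differentiability makes [u - G (y + s *: v + u *m K)] a contraction in [u] on a small ball, and
    its fixed point is a zero of [G]. *)
Lemma zero_along_tangent (v : 'rV[C]_m) (e d : C) :
  v *m J = 0 -> 0 < e -> 0 < d ->
  exists2 s, 0 < s <= d & exists2 z, G z = 0 & `|z - y - s *: v| <= e * s.
Proof.
move=> vJ e0 d0; have [c c0 hc] := mulmx_bounded K.
have v1 : 0 < `|v| + 1 by rewrite ltr_wpDl.
have ve : 0 < `|v| + e by rewrite ltr_wpDl.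
(* The first bound gives the contraction factor 1/2, the second places [psi 0] in the ball of half
   the radius. *)
have [e1 [e10 e1c e1e]] : exists e1 : C,
    [/\ 0 < e1, e1 <= (2 * c)^-1 & e1 <= e / (2 * c * (`|v| + 1))].
  by apply: pos_min2; rewrite ?invr_gt0 ?divr_gt0 ?mulr_gt0.
have [D D0 hD] := GJ e10.
(* The bound by [D] keeps all the points [pt u] within reach of [hD]. *)
have [s [s0 sd sD]] : exists s : C,
    [/\ 0 < s, s <= d & s <= D / 2 / (`|v| + e)].
  by apply: pos_min2; rewrite ?divr_gt0.
have {}sD : s * (`|v| + e) < D.
  rewrite (@le_lt_trans _ _ (D / 2))// -?ler_pdivlMr//.
  by rewrite ltr_pdivrMr// mulrDr mulr1 ltrDl.
exists s; first by rewrite s0.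
(* With this radius the correction [u *m K] has norm at most [e * s]. *)
pose r := e * s / c; pose pt (u : 'rV[C]_k) : 'rV[C]_m := y + s *: v + u *m K.
have r0 : 0 <= r by rewrite divr_ge0 ?mulr_ge0// ltW.
have ptE (u : 'rV[C]_k) : pt u - y = s *: v + u *m K.
  by rewrite /pt -(addrA y) [y + _]addrC addrK.
have uK (u : 'rV[C]_k) : `|u| <= r -> `|u *m K| <= e * s.
  by move=> ur; rewrite (le_trans (hc u))// mulrC -ler_pdivlMr.
have ptD (u : 'rV[C]_k) : `|u| <= r -> `|pt u - y| < D.
  move=> ur; rewrite ptE (le_lt_trans _ sD)//.
  rewrite (le_trans (ler_normD _ _))// normrZ mulrDr (gtr0_norm s0).
  by rewrite lerD2l mulrC uK.
pose psi (u : 'rV[C]_k) := u - G (pt u).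
have contr (u w : 'rV[C]_k) : 
    `|u| <= r -> `|w| <= r -> `|psi u - psi w| <= 2^-1 * `|u - w|.
  move=> ur wr.
  have ptB : pt u - pt w = (u - w) *m K.
    by rewrite /pt opprD addrACA subrr add0r mulmxBl.
  have -> : psi u - psi w = - (G (pt u) - G (pt w) - (pt u - pt w) *m J).
    by rewrite ptB -mulmxA KJ mulmx1 /psi !opprD !opprK addrACA addrC.
  rewrite normrN (le_trans (hD _ _ (ptD _ ur) (ptD _ wr)))// ptB.
  rewrite (le_trans (ler_wpM2l (ltW e10) (hc _)))// mulrA ler_wpM2r//.
  rewrite -ler_pdivlMr// (le_trans e1c)// invfM.
  by rewrite lexx.
(* As [G y = 0] and [v *m J = 0], the value of [G] at [y + s *: v] is pure error term. *)
have psi0 : `|psi 0| <= 2^-1 * r.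
  have n0 : `|0 : 'rV[C]_k| <= r by rewrite normr0.
  rewrite /psi sub0r normrN.
  have := hD (pt 0) y (ptD _ n0); rewrite subrr normr0 => /(_ D0).
  rewrite ptE mul0mx addr0 Gy subr0 -scalemxAl vJ scaler0 subr0 => /le_trans.
  apply; rewrite normrZ (gtr0_norm s0).
  rewrite (@le_trans _ _ (e / (2 * c * (`|v| + 1)) * (s * (`|v| + 1))))//.
    by rewrite ler_pM// ?mulr_ge0// ?(ltW s0)// ?(ltW e10)// ler_pM2l// lerDl.
  rewrite /r (_ : _ * _ = 2^-1 * (e * s / c))//; field.
  by rewrite !gt_eqF.
have stab (u : 'rV[C]_k) : `|u| <= r -> `|psi u| <= r.
  move=> ur; have n0 : `|0 : 'rV[C]_k| <= r by rewrite normr0.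
  rewrite -(subrK (psi 0) (psi u)) (le_trans (ler_normD _ _))//.
  rewrite [leRHS](splitr r) lerD// mulrC//.
  by rewrite (le_trans (contr _ _ ur n0))// subr0 ler_wpM2l// invr_ge0.
have [u ur up] := contraction_ball_fixpoint r0 stab contr.
exists (pt u).
  by apply/eqP; rewrite -oppr_eq0 -(inj_eq (addrI u)) addr0; exact/eqP.
by rewrite ptE [_ + u *m K]addrC addrK uK.
Qed.

End implicit.
End StrictDiff.

(** * Strict differentiability of analytic functions *)

Section MonomialBounds.
Variable K : numFieldType.

(** For [t] at most 1/2 the sequence [n * t ^ n] does not increase from [n = 2] on. *)
Lemma natr_mul_exp_le (t : K) (n : nat) : 0 <= t -> t <= 2^-1 -> (2 <= n)%N ->
  n%:R * t ^+ n <= 2 * t ^+ 2.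
Proof.
move=> t0 t2; case: n => [|[|n]]// _; elim: n => [//|n IH].
apply: le_trans IH; rewrite exprS mulrA ler_wpM2r ?exprn_ge0//.
rewrite (le_trans (ler_wpM2l _ t2))// ler_pdivrMr// -natrM ler_nat.
by rewrite muln2 -addnn addSn ltnS addnS ltnS leq_addr.
Qed.

(* The Lipschitz clause is multiplied by [r] to avoid the exponent [n.-1]. *)
Definition monomial_bound (r d : K) (x y : K) (n : nat) :=
  [/\ `|x| <= r ^+ n, `|y| <= r ^+ n & r * `|x - y| <= n%:R * r ^+ n * d].

(** The Lipschitz constants add up by the Leibniz splitting of [x * x' - y * y']. *)
Lemma monomial_boundM r d x y n x' y' n' : 0 <= r ->
  monomial_bound r d x y n -> monomial_bound r d x' y' n' ->
  monomial_bound r d (x * x') (y * y') (n + n').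
Proof.
move=> r0 [hx hy hxy] [hx' hy' hxy'].
split; rewrite ?normrM ?exprD; try exact: ler_pM.
have -> : x * x' - y * y' = (x - y) * x' + y * (x' - y').
  by rewrite mulrBl mulrBr addrA subrK.
rewrite (le_trans (ler_wpM2l r0 (ler_normD _ _)))// !normrM mulrDr natrD.
have -> : (n%:R + n'%:R) * (r ^+ n * r ^+ n') * d =
    n%:R * r ^+ n * d * r ^+ n' + r ^+ n * (n'%:R * r ^+ n' * d) by ring.
rewrite lerD// ?mulrA; first by rewrite ler_pM// mulr_ge0.
rewrite [r * _]mulrC -!mulrA ler_pM// ?mulr_ge0//.
by rewrite [leRHS]mulrA.
Qed.

Lemma monomial_bound_prod m (w w' : 'rV[K]_m) (r : K) (a : 'I_m -> nat) :
  `|w| <= r -> `|w'| <= r ->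
  monomial_bound r `|w - w'| (\prod_i w 0 i ^+ a i) (\prod_i w' 0 i ^+ a i)
    (\sum_i a i)%N.
Proof.
move=> wr wr'; have r0 : 0 <= r := le_trans (normr_ge0 _) wr.
have one d : monomial_bound r d 1 1 0.
  by split; rewrite ?normr1// subrr normr0 mulr0 !mul0r.
elim/big_ind3: _ => // [x1 x2 x3 y1 y2 y3 hx hy|i _].
  exact: monomial_boundM.
elim: (a i) => [|n IH]; first by rewrite !expr0.
rewrite !exprS -(add1n n); apply: monomial_boundM => //; split.
- by rewrite expr1 (le_trans (rV_entry_le w i)).
- by rewrite expr1 (le_trans (rV_entry_le w' i)).
- rewrite mul1r expr1 ler_wpM2l//.
  by have := rV_entry_le (w - w') i; rewrite !mxE.
Qed.

End MonomialBounds.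

Section Analytic.
Variables (R : realType) (m : nat).
Local Notation C := (Cplx R).
Local Notation V := ('rV[C]_m).

(** Both points vary, unlike in Fréchet differentiability; the contraction and the continuity of the
    gradient rely on this. *)
Definition strict_differential (f : V -> C) (p L : V) := forall e : C, 0 < e ->
  exists2 d : C, 0 < d & forall z z' : V, `|z - p| < d -> `|z' - p| < d ->
    `|f z - f z' - pairing L (z - z')| <= e * `|z - z'|.

Lemma sum_nat_eq1_indicator (a : 'I_m -> nat) : (\sum_i a i = 1)%N ->
  exists i, a = fun j => (j == i) : nat.
Proof.
move=> a1; have [i ai] : exists i, a i != 0%N.
  apply/existsP; apply: contra_eqT a1; rewrite negb_exists => /forallP a0.
  by rewrite big1// => i _; have := a0 i; rewrite negbK => /eqP.
exists i; move: a1; rewrite (bigD1 i)//=.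
case ak: (a i) ai => [//|k] _; rewrite addSn => -[] /eqP.
rewrite addn_eq0 => /andP[/eqP k0]; rewrite sum_nat_eq0 => /forallP h.
apply/funext => j; have [->|ji] := eqVneq j i; first by rewrite ak k0.
by have := h j; rewrite ji => /eqP.
Qed.

Definition box_sum (c : ('I_m -> nat) -> C) (n : nat) (z : V) : C :=
  \sum_(a : {ffun 'I_m -> 'I_n}) c (fun i => a i : nat) * \prod_i z 0 i ^+ a i.

Definition linear_part (c : ('I_m -> nat) -> C) : V :=
  \row_i c (fun j => (j == i) : nat).

(** The estimate is made term by term: constants cancel, terms of degree 1 are the linear part, and
    a monomial of degree [N >= 2] has Lipschitz constant at most [N * (t * r) ^ N / (t * r)], hence
    at most [2 * t / r * r ^ N]. The bound does not depend on [n]. *)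
Lemma box_sum_strict_bound (c : ('I_m -> nat) -> C) (r M t : C) n (w w' : V) :
  (2 <= n)%N -> 0 < r -> 0 < t -> t <= 2^-1 ->
  \sum_(a : {ffun 'I_m -> 'I_n})
     `|c (fun i => a i : nat)| * r ^+ (\sum_i (a i : nat))%N <= M ->
  `|w| <= t * r -> `|w'| <= t * r ->
  `|box_sum c n w - box_sum c n w' - pairing (linear_part c) (w - w')|
     <= 2 * t / r * M * `|w - w'|.
Proof.
case: n => [|[|n]]// _ r0 t0 t2 cM wr wr'.
(* The multi-index of the [i]-th coordinate; its values 0 and 1 lie in the range because the box has
   side at least 2. *)
pose e_ (i : 'I_m) : {ffun 'I_m -> 'I_n.+2} := [ffun j => inord (j == i)].
have eE i : (fun j => e_ i j : nat) = (fun j => (j == i) : nat).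
  by apply/funext => j; rewrite ffunE inordK//; case: eqP.
(* The linear part is spread over all multi-indices so that the sums can be subtracted term by
   term. *)
pose lin (a : {ffun 'I_m -> 'I_n.+2}) :=
  \sum_(i | a == e_ i) c (fun j => a j : nat) * (w - w') 0 i.
have linE : pairing (linear_part c) (w - w') = \sum_a lin a.
  rewrite [RHS](exchange_big_dep xpredT)//=; apply: eq_bigr => i _.
  by rewrite big_pred1_eq eE mxE.
rewrite linE /box_sum -!sumrB (le_trans (ler_norm_sum _ _ _))//.
rewrite -mulrA [M * _]mulrC mulrA.
have b0 : 0 <= 2 * t / r * `|w - w'|.
  by rewrite mulr_ge0// divr_ge0 ?mulr_ge0// ltW.
rewrite (le_trans _ (ler_wpM2l b0 cM))// mulr_sumr; apply: ler_sum => a _.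
set N := (\sum_i _)%N.
have [_ _] := monomial_bound_prod (fun i => a i : nat) wr wr'.
rewrite -mulrBr -/N; set P := \prod_i _ - \prod_i _ => hP.
have eN i : a == e_ i -> N = 1%N.
  move=> /eqP ai; rewrite /N (eq_bigr (fun j => (j == i) : nat)) => [|j _].
    by rewrite -big_mkcond/= big_pred1_eq.
  by rewrite ai -[RHS](congr1 (@^~ j) (eE i)).
have tr0 : 0 < t * r by rewrite mulr_gt0.
have [N1|N1] := eqVneq N 1%N; last first.
  rewrite /lin big_pred0 ?subr0; last first.
    by move=> i; apply: contra_neqF N1; exact: eN.
  rewrite normrM mulrCA ler_wpM2l// -(ler_pM2l tr0) (le_trans hP)//.
  have -> : t * r * (2 * t / r * `|w - w'| * r ^+ N) =
    (2 * t ^+ 2) * r ^+ N * `|w - w'| by field; rewrite gt_eqF.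
  rewrite exprMn mulrA.
  rewrite !ler_wpM2r// ?exprn_ge0 ?(ltW r0)//.
  case: N N1 {hP eN} => [|[|N]]// _; last by rewrite natr_mul_exp_le// ltW.
  by rewrite mul0r mulr_ge0 ?exprn_ge0 ?(ltW t0).
have [i0 ai0] := sum_nat_eq1_indicator N1.
have ae : a = e_ i0.
  apply/ffunP => j; apply/val_inj.
  rewrite /= -[RHS]/((fun j => e_ i0 j : nat) j).
  by rewrite eE -[LHS]/((fun j => a j : nat) j) ai0.
have mono (z : V) : \prod_i z 0 i ^+ a i = z 0 i0.
  rewrite (bigD1 i0)//= big1 => [|j ji].
    by rewrite (congr1 (@^~ i0) ai0) eqxx expr1 mulr1.
  by rewrite (congr1 (@^~ j) ai0) (negbTE ji) expr0.
rewrite (_ : _ - lin a = 0).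
  by rewrite normr0 (mulr_ge0 b0)// mulr_ge0// exprn_ge0// ltW.
rewrite /P !mono /lin (big_pred1 i0).
  by rewrite !mxE subrr.
move=> i; rewrite /= ae; apply/eqP/eqP => [|->//].
move=> h; have /= := congr1 (@^~ i0) (eE i0).
by rewrite h -[LHS]/((fun j => e_ i j : nat) i0) eE eqxx; case: eqP.
Qed.

(** The bound on box sums is uniform in [n], so it passes to the limit. *)
Lemma analytic_strict_differential (f : V -> C) (p : V) : analytic_at f p ->
  exists L, strict_differential f p L.
Proof.
move=> [c [r [M [r0 cM cf]]]]; exists (linear_part c) => e e0.
have M0 : 0 <= M.
  rewrite (le_trans _ (cM 0%N))// sumr_ge0// => a _.
  by rewrite mulr_ge0// exprn_ge0// ltW.
have M1 : 0 < M + 1 by rewrite ltr_wpDl.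
(* The last condition makes [2 * t / r * M] at most [e]; [M + 1] avoids a division by zero. *)
have [t [t0 t2 te]] : exists t : C,
    [/\ 0 < t, t <= 2^-1 & t <= e * r / (2 * (M + 1))].
  by apply: pos_min2; rewrite ?invr_gt0// divr_gt0 ?mulr_gt0.
have tr0 : 0 < t * r by rewrite mulr_gt0.
have trr : t * r < r by rewrite gtr_pMl// (le_lt_trans t2)// invf_lt1// ltr1n.
exists (t * r) => // z z' zp z'p.
have ptE (y : V) : p + (y - p) = y by rewrite addrC subrK.
have lim (y : V) : `|y - p| < t * r -> box_sum c n (y - p) @[n --> \oo] --> f y.
  move=> yp; rewrite -{2}[y]ptE; apply: cf => i.
  by rewrite (le_lt_trans (rV_entry_le _ _))// (lt_trans yp).
apply/ler_addgt0Pr => e' e'0.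
have [n0 _ hn] := (cvgrPdist_lt _ _).1 (cvgB (lim _ zp) (lim _ z'p)) _ e'0.
have := hn (maxn 2 n0) (leq_maxr _ _); set n := maxn 2 n0.
have := @box_sum_strict_bound c r M t n (z - p) (z' - p)
  (leq_maxl _ _) r0 t0 t2 (cM n) (ltW zp) (ltW z'p).
have -> : z - p - (z' - p) = z - z' by rewrite opprB addrA subrK.
set S := box_sum c n (z - p) - box_sum c n (z' - p) => hS hL.
rewrite (_ : f z - f z' - _ =
    S - pairing (linear_part c) (z - z') + (f z - f z' - S)); last first.
  by rewrite [RHS]addrC [RHS]addrA subrK.
rewrite (le_trans (ler_normD _ _))// lerD//; last exact: ltW.
rewrite (le_trans hS)// ler_wpM2r//.
rewrite (@le_trans _ _ (2 * t / r * (M + 1)))//.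
  by rewrite ler_wpM2l ?lerDl// divr_ge0 ?mulr_ge0// ltW.
move: te; rewrite ler_pdivlMr ?mulr_gt0// => te.
rewrite -(ler_pM2r r0); apply: le_trans te; rewrite le_eqVlt; apply/orP; left.
by apply/eqP; field; rewrite gt_eqF.
Qed.

Lemma strict_differential_derive (f : V -> C) (p L v : V) :
  strict_differential f p L -> 'D_v f p = pairing L v.
Proof.
move=> fL; apply: cvg_lim => //.
apply/cvgrPdist_le => e e0.
have v1 : 0 < `|v| + 1 by rewrite ltr_wpDl.
have [d d0 hd] := fL (e / (`|v| + 1)) (divr_gt0 e0 v1).
apply/nbhs_ballP; exists (d / (`|v| + 1)); first by rewrite /= divr_gt0.
move=> h; rewrite -ball_normE /= sub0r normrN => hd' h0.
rewrite /= distrC.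
have -> : h^-1 *: (f (h *: v + p) - f p) - pairing L v =
   h^-1 * (f (h *: v + p) - f p - pairing L (h *: v)).
  by rewrite mulrBr pairingZr mulKf.
have hv : `|h *: v| < d.
  rewrite normrZ (@le_lt_trans _ _ (`|h| * (`|v| + 1)))//.
    by rewrite ler_wpM2l// lerDl.
  by rewrite -ltr_pdivlMr.
have := hd (h *: v + p) p; rewrite subrr normr0 addrK => /(_ hv d0) hh.
rewrite normrM normfV ler_pdivrMl ?normr_gt0// (le_trans hh)// normrZ.
rewrite mulrCA ler_wpM2l// -mulrA ler_piMr ?(ltW e0)//.
by rewrite ler_pdivrMl// mulr1 lerDl.
Qed.

Lemma strict_differential_grad (f : V -> C) (p L : V) :
  strict_differential f p L -> grad f p = L.
Proof.
move=> fL; apply/rowP => i.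
by rewrite mxE (strict_differential_derive _ fL) pairing_delta.
Qed.

(** On a short increment from [q] along a coordinate axis, both [L] and [L'] approximate the
    variation of [f] up to [e / 2] times its length, so their entries differ by at most [e]. *)
Lemma strict_differential_continuous (f : V -> C) (p L : V) (e : C) : 0 < e ->
  strict_differential f p L -> exists2 d : C, 0 < d & forall q L',
    `|q - p| < d -> strict_differential f q L' -> `|L' - L| <= e.
Proof.
move=> e0 fL; have e20 : 0 < e / 2 by rewrite divr_gt0.
have [d d0 hd] := fL _ e20; exists (d / 2); first by rewrite divr_gt0.
move=> q L' qp fL'; apply/rV_norm_leP => [|i]; first exact: ltW.
have [d' d'0 hd'] := fL' _ e20.
have [h [h0 hd2 hdd']] : exists h : C, [/\ 0 < h, h <= d / 2 / 2 & h <= d' / 2].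
  by apply: pos_min2; rewrite !divr_gt0.
have half (x : C) : 0 < x -> x / 2 < x.
  by move=> x0; rewrite ltr_pdivrMr// mulrDr mulr1 ltrDl.
pose u : V := h *: delta_mx 0 i.
have uh : `|u| <= h.
  rewrite normrZ (gtr0_norm h0) ler_piMr ?(ltW h0)//.
  apply/rV_norm_leP => // j; rewrite !mxE.
  by case: andP; rewrite ?normr0 ?normr1.
have ud' : `|u| < d' by rewrite (le_lt_trans uh)// (le_lt_trans hdd')// half.
have qup : `|q + u - p| < d.
  rewrite addrAC (le_lt_trans (ler_normD _ _))// [ltRHS](splitr d) ltrD//.
  by rewrite (le_lt_trans uh)// (le_lt_trans hd2)// half// divr_gt0.
have := hd (q + u) q qup (lt_trans qp (half _ d0)).
have := hd' (q + u) q; rewrite subrr normr0 [q + u]addrC addrK => /(_ ud' d'0).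
move=> h1 h2.
have : `|pairing (L' - L) u| <= e * h.
  rewrite (_ : pairing _ _ = (f (u + q) - f q - pairing L u) -
    (f (u + q) - f q - pairing L' u)); last first.
    by rewrite pairingBl; ring.
  rewrite (le_trans (ler_normB _ _))// (le_trans (lerD h2 h1))//.
  by rewrite -mulrDl -splitr ler_wpM2l// ltW.
by rewrite pairingZr pairing_delta normrM (gtr0_norm h0) mulrC ler_pM2r.
Qed.

Lemma strict_differential_lipschitz (f : V -> C) (p L : V) :
  strict_differential f p L -> exists2 c : C, 0 < c &
    exists2 d : C, 0 < d & forall z z', `|z - p| < d -> `|z' - p| < d ->
      `|f z - f z'| <= c * `|z - z'|.
Proof.
move=> fL; have [c c0 hc] := pairing_bounded L.
have [d d0 hd] := fL 1 ltr01; exists (1 + c); first by rewrite addr_gt0.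
exists d => // z z' zp z'p.
rewrite -(subrK (pairing L (z - z')) (f z - f z')) (le_trans (ler_normD _ _))//.
by rewrite mulrDl lerD// hd.
Qed.

End Analytic.

(** * Almost conormal covectors at smooth points *)

Section SmoothPoints.
Variables (R : realType) (m : nat).
Local Notation C := (Cplx R).
Local Notation V := ('rV[C]_m).
Local Open Scope sesquilinear_scope.
Local Notation "B ^!" :=
  (orthomx Num.conj (mx_of_hermitian (hermitian1mx _)) B) : matrix_set_scope.

Lemma analytic_strict_differential_grad (f : V -> C) (p : V) :
  analytic_at f p -> strict_differential f p (grad f p).
Proof.
move=> /analytic_strict_differential[L fL].
by rewrite (strict_differential_grad fL).
Qed.

Section at_point.
Variables (X : set V) (y : V) (k : nat) (g : 'I_k -> V -> C).
Local Notation A := (\matrix_(i < k, j < m) grad (g i) y 0 j).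
Hypothesis Xy : X y.
Hypothesis anag : forall i, analytic_at (g i) y.
Hypothesis freeA : row_free A.
Hypothesis gX : \forall z \near y, X z <-> forall i, g i z = 0.

(** Freeness of the Jacobian provides the one-sided inverse required by [zero_along_tangent]. *)
Lemma smooth_point_curve (v : V) (e d : C) :
  (forall i, pairing (grad (g i) y) v = 0) -> 0 < e -> 0 < d ->
  exists2 s, 0 < s <= d & exists2 z, X z & `|z - y - s *: v| <= e * s.
Proof.
move=> vA e0 d0; have /row_freeP[B AB] := freeA.
pose G (z : V) : 'rV[C]_k := \row_i g i z.
have mulA (w : V) i : (w *m A^T) 0 i = pairing (grad (g i) y) w.
  by rewrite mxE; apply: eq_bigr => j _; rewrite !mxE mulrC.
have BA : B^T *m A^T = 1%:M by rewrite -trmx_mul AB trmx1.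
have Gy : G y = 0.
  by apply/rowP => i; rewrite !mxE (nbhs_singleton gX).1.
have vA0 : v *m A^T = 0 by apply/rowP => i; rewrite mulA vA mxE.
have GA (e1 : C) : 0 < e1 -> exists2 d1 : C, 0 < d1 &
  forall z z' : V, `|z - y| < d1 -> `|z' - y| < d1 ->
    `|G z - G z' - (z - z') *m A^T| <= e1 * `|z - z'|.
  move=> e10.
  have /choice[dd hdd] : forall i, exists d1 : C, 0 < d1 /\
      forall z z' : V, `|z - y| < d1 -> `|z' - y| < d1 ->
      `|g i z - g i z' - pairing (grad (g i) y) (z - z')| <= e1 * `|z - z'|.
    move=> i; have [d1 ? ?] := analytic_strict_differential_grad (anag i) e10.
    by exists d1.
  have [d1 d10 d1le] := pos_min_ord (fun i => (hdd i).1).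
  exists d1 => // z z' zy z'y; apply/rV_norm_leP => [|i].
    by rewrite mulr_ge0// ltW.
  have := (hdd i).2 z z' (lt_le_trans zy (d1le i)) (lt_le_trans z'y (d1le i)).
  by rewrite -mulA; move: ((z - z') *m _) => W; rewrite !mxE.
have /nbhs_ballP[r r0 hr] := gX.
have ve : 0 < `|v| + e by rewrite ltr_wpDl.
(* The second bound keeps the zero found inside the ball where [X] is the zero set of the [g i]. *)
have [d' [d'0 d'd d'r]] : exists d' : C,
    [/\ 0 < d', d' <= d & d' <= r / 2 / (`|v| + e)].
  by apply: pos_min2; rewrite ?divr_gt0.
have [s /andP[s0 sd] [z Gz zs]] := zero_along_tangent BA Gy GA vA0 e0 d'0.
exists s; first by rewrite s0 (le_trans sd).
exists z => //; apply/hr => [|i]; last first.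
  by have := congr1 (fun M : 'rV_k => M 0 i) Gz; rewrite !mxE.
rewrite -ball_normE /= distrC -(subrK (s *: v) (z - y)).
rewrite (le_lt_trans (ler_normD _ _))// normrZ (gtr0_norm s0).
rewrite (le_lt_trans (lerD zs (lexx _)))// [e * s]mulrC -mulrDr addrC.
rewrite (@le_lt_trans _ _ (r / 2))//.
  by rewrite -ler_pdivlMr// (le_trans sd).
by rewrite ltr_pdivrMr// mulrDr mulr1 ltrDl.
Qed.

(** For points [z] of [X] close to [y + s *: v], the quotient [(F z - F y) / s] approximates
    [pairing L v], and the Lipschitz hypothesis bounds it. *)
Lemma grad_ker_bound (F : V -> C) (L : V) (c r : C) (v : V) :
  strict_differential F y L -> 0 <= c -> 0 < r ->
  (forall z, X z -> `|z - y| < r -> `|F z - F y| <= c * `|z - y|) ->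
  (forall i, pairing (grad (g i) y) v = 0) ->
  `|pairing L v| <= c * `|v|.
Proof.
move=> FL c0 r0 hF vA; have [b b0 hb] := pairing_bounded L.
apply/ler_addgt0Pr => e' e'0.
(* All error terms, divided by [s], add up to at most [e * B] once [e <= 1]. *)
pose B := c + `|v| + 1 + b.
have B0 : 0 < B by rewrite ltr_wpDl ?b0// !addr_ge0.
have [e [e0 e1 eB]] : exists e : C, [/\ 0 < e, e <= 1 & e <= e' / B].
  by apply: pos_min2; rewrite ?divr_gt0.
have [d d0 hd] := FL _ e0.
have [d1 [d10 d1d d1r]] := pos_min2 d0 r0.
have ve : 0 < `|v| + e by rewrite ltr_wpDl.
have q0 : 0 < d1 / 2 / (`|v| + e) by rewrite !divr_gt0.
have [s /andP[s0 sd] [z Xz zs]] := smooth_point_curve vA e0 q0.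
have zy : `|z - y| <= s * (`|v| + e).
  rewrite -(subrK (s *: v) (z - y)) (le_trans (ler_normD _ _))//.
  by rewrite normrZ (gtr0_norm s0) mulrDr addrC lerD2l [s * e]mulrC.
have zyd : `|z - y| < d1.
  rewrite (le_lt_trans zy)// (@le_lt_trans _ _ (d1 / 2))//.
    by rewrite -ler_pdivlMr.
  by rewrite ltr_pdivrMr// mulrDr mulr1 ltrDl.
have := hd z y (lt_le_trans zyd d1d); rewrite subrr normr0 => /(_ d0) h1.
have h2 := hF z Xz (lt_le_trans zyd d1r).
have h3 := hb (z - y - s *: v).
rewrite -(ler_pM2l s0).
have -> : s * `|pairing L v| = `|F z - F y - (F z - F y - pairing L (z - y))
    - pairing L (z - y - s *: v)|.
  rewrite -{1}(gtr0_norm s0) -normrM -pairingZr !pairingBr.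
  by congr (`|_|); ring.
rewrite (le_trans (ler_normB _ _))//.
rewrite (le_trans (lerD (le_trans (ler_normB _ _) (lerD h2 h1)) h3))//.
rewrite -mulrDl.
rewrite (@le_trans _ _ ((c + e) * (s * (`|v| + e)) + b * (e * s)))//.
  by rewrite lerD// ?ler_wpM2l// ?addr_ge0// ltW.
have -> : (c + e) * (s * (`|v| + e)) + b * (e * s) =
  s * (c * `|v| + e * (c + `|v| + e + b)) by ring.
rewrite ler_pM2l// lerD2l.
move: eB; rewrite ler_pdivlMr//; apply: le_trans; rewrite ler_pM2l//.
by rewrite /B !lerD2r lerD2l.
Qed.

(* [L - D] is in the row space of the Jacobian and the conjugate of [D] is
   killed by the Jacobian, so the squared Hermitian norm of [D] is the
   pairing of [L] with this conjugate. *)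
Lemma almost_conormal_at (F : V -> C) (L : V) (c r : C) :
  strict_differential F y L -> 0 <= c -> 0 < r ->
  (forall z, X z -> `|z - y| < r -> `|F z - F y| <= c * `|z - y|) ->
  exists2 D : V, `|D| <= c & forall v, tangent X y v -> pairing (L - D) v = 0.
Proof.
(* [D] is the component of [L] orthogonal to the rows of the Jacobian for the Hermitian product. *)
move=> FL c0 r0 hF; pose D := L *m proj_ortho A^!%MS.
have LD : L - D = L *m proj_ortho A.
  by rewrite -{1}(add_proj_ortho A L) addrK.
exists D; last first.
  move=> v tv.
  (* A combination of the gradients of the [g i] kills the tangent space because each [g i] vanishes
     on [X] near [y]. *)
  have /submxP[w ->] : (L - D <= A)%MS by rewrite LD proj_ortho_sub.
  rewrite /pairing (eq_bigr (fun j =>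
      \sum_i w 0 i * (grad (g i) y 0 j * v 0 j))).
    rewrite exchange_big/= big1// => i _; rewrite -mulr_sumr.
    rewrite [X in _ * X](tv (g i))// ?mulr0//.
    by near=> z => Xz; apply: (near gX z _).1.
  move=> j _; rewrite mxE mulr_suml; apply: eq_bigr => i _.
  by rewrite mxE mulrA.
have DA : D *m A ^t* = 0 by apply/orthomx1P; rewrite proj_ortho_sub.
pose v : V := map_mx Num.conj D.
have vE w : pairing w v = (w *m D ^t*) 0 0.
  by rewrite mxE; apply: eq_bigr => j _; rewrite !mxE.
have ADt i : pairing (grad (g i) y) v = 0.
  have := congr1 (fun M : 'M[C]_(1, k) => Num.conj (M 0 i)) DA.
  rewrite !mxE rmorph0 rmorph_sum => h; rewrite -[RHS]h; apply: eq_bigr => j _.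
  rewrite rmorphM [v 0 j]mxE mulrC; congr (_ * _).
  have -> : (A ^t*) j i = Num.conj (grad (g i) y 0 j).
    by rewrite mxE; congr (Num.conj _); rewrite mxE; exact: mxE.
  by rewrite /= conjCK.
have LDD : pairing L v = \sum_i `|D 0 i| ^+ 2.
  rewrite -(subrK D L) pairingDl vE.
  have [B ->] : exists B, L - D = B *m A.
    by apply/submxP; rewrite LD proj_ortho_sub.
  have -> : B *m A *m D ^t* = 0.
    apply/matrixP => a b; rewrite -mulmxA mxE big1 ?mxE// => i _.
    rewrite (_ : (A *m D ^t*) i b = 0) ?mulr0// -[RHS](ADt i) mxE.
    by apply: eq_bigr => j _; rewrite !mxE ord1.
  rewrite mxE add0r; apply: eq_bigr => i _; rewrite normCK.
  by congr (_ * _); rewrite mxE; congr (Num.conj _); exact: mxE.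
have vD : `|v| <= `|D|.
  by apply/rV_norm_leP => // i; rewrite mxE norm_conjC rV_entry_le.
have := grad_ker_bound FL c0 r0 hF ADt => /le_trans/(_ (ler_wpM2l c0 vD)).
have [->|D0] := eqVneq D 0; first by rewrite normr0.
(* The sup norm is attained at an entry, so its square is at most the Hermitian one, itself at most
   [c] times the sup norm of [D]; dividing by this norm concludes. *)
have [[a i] Di] : exists i, `|D| = `|D i.1 i.2|.
  apply: (@mx_norm_neq0 _ _ _ D); apply: contra_neq D0; exact: mx_norm_eq0.
rewrite /= ord1 in Di.
rewrite LDD ger0_norm; last by apply: sumr_ge0 => j _; exact: exprn_ge0.
move=> /(le_trans _) h; rewrite -(@ler_pM2r _ `|D|) ?normr_gt0//.
by apply: h; rewrite (bigD1 i)//= -Di -expr2 lerDl sumr_ge0.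
Unshelve. all: by end_near. Qed.

End at_point.

Lemma almost_conormal (X : set V) (y : V) (F : V -> C) (L : V) (c r : C) :
  smooth_point X y -> strict_differential F y L -> 0 <= c -> 0 < r ->
  (forall z, X z -> `|z - y| < r -> `|F z - F y| <= c * `|z - y|) ->
  exists2 D : V, `|D| <= c & forall v, tangent X y v -> pairing (L - D) v = 0.
Proof.
move=> [Xy [k [g [ag fg gX]]]]; exact: almost_conormal_at Xy ag fg gX _ _ _ _.
Qed.

End SmoothPoints.

(** * Topology of the projective space *)

Section PspaceTopology.
Local Open Scope quotient_scope.
Variables (R : realType) (m : nat).
Local Notation C := (Cplx R).
Local Notation V := ('rV[C]_m).
Local Notation P := (Pspace R m).

Lemma is_pclass_ex (v : V) : v != 0 -> exists a : P, is_pclass v a.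
Proof.
move=> v0; pose u : @nonzero R m := exist _ v (@mem_set _ (@nonzero R m) v v0).
by exists (pclass u), u.
Qed.

Lemma is_pclass_neq0 (v : V) (a : P) : is_pclass v a -> v != 0.
Proof. by move=> [u [<- _]]; exact: set_mem (valP u). Qed.

Lemma pclass_eqP (u v : @nonzero R m) :
  pclass u = pclass v <-> exists c : C, c != 0 /\ val u = c *: val v.
Proof. by split=> [/eqquotP/asboolP//|h]; apply/eqquotP/asboolP. Qed.

Lemma is_pclassZ (v : V) (a : P) (c : C) :
  c != 0 -> is_pclass v a -> is_pclass (c *: v) a.
Proof.
move=> c0 va; have cv0 : c *: v != 0.
  by rewrite scaler_eq0 negb_or c0 (is_pclass_neq0 va).
pose cu : @nonzero R m :=
  exist _ (c *: v) (@mem_set _ (@nonzero R m) (c *: v) cv0).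
case: va => u [uv <-]; exists cu; split=> //.
by apply/pclass_eqP; exists c; rewrite uv.
Qed.

Lemma is_pclass_prop (v w : V) (a : P) : is_pclass v a -> is_pclass w a ->
  exists2 c : C, c != 0 & v = c *: w.
Proof.
move=> [u [<- ua]] [u' [<- u'a]].
have /pclass_eqP[c [c0 e]] := etrans ua (esym u'a).
by exists c.
Qed.

Lemma is_pclass_uniq (v : V) (a b : P) :
  is_pclass v a -> is_pclass v b -> a = b.
Proof.
move=> [u [uv <-]] [u' [u'v <-]]; apply/pclass_eqP; exists 1.
by rewrite oner_neq0 scale1r uv u'v.
Qed.

(** Continuity of the quotient map, expressed with neighborhoods in [V] rather than in the subtype
    of nonzero vectors. *)
Lemma nbhs_pclass (v : V) (a : P) (N : set P) : is_pclass v a -> nbhs a N ->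
  \forall w \near v, forall b, is_pclass w b -> N b.
Proof.
move=> [u [<- <-]]; rewrite nbhsE => -[N' [oN' N'u] sN].
have /= [B oB BN] : open (@pclass R m @^-1` N') by exact: oN'.
have BE (u' : @nonzero R m) : B (val u') = N' (pclass u') := congr1 (@^~ u') BN.
have Bu : B (val u) by rewrite BE.
apply: filterS (open_nbhs_nbhs (conj oB Bu)) => w Bw b [u' [u'w <-]].
by apply: sN; rewrite -BE u'w.
Qed.

(** The quotient map is open: the saturation of an open set is the union of its preimages under the
    nonzero homotheties. *)
Lemma pclass_open (v : V) (a : P) (W : set V) : is_pclass v a -> nbhs v W ->
  nbhs a [set b | exists2 w, W w & is_pclass w b].
Proof.
move=> va nW; have [W' [oW' W'v] sW] : exists2 B, open_nbhs v B & B `<=` W.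
  by move: nW; rewrite nbhsE => -[B]; exists B.
rewrite nbhsE; exists [set b | exists2 w, W' w & is_pclass w b]; last first.
  by move=> b [w /sW]; exists w.
split; last by exists v.
suff : open (@pclass R m @^-1` [set b | exists2 w, W' w & is_pclass w b]) by [].
exists (\bigcup_(c in [set c : C | c != 0]) ((fun v : V => c *: v) @^-1` W')).
  apply: bigcup_open => c _; apply: open_comp => // w _.
  exact: scaler_continuous.
apply/seteqP; split=> u /=.
  move=> [c /= c0 Wcu]; exists (c *: val u) => //.
  by apply: is_pclassZ => //; exists u.
move=> [w Ww [u' [u'w /pclass_eqP[c [c0 e]]]]]; exists c => //.
suff : W' (c *: val u) by [].
by rewrite -e u'w.
Qed.

End PspaceTopology.

(** * Closures and limits in products *)

Section Closures.

(** Continuity is asked only at [p], since that of [grad ft] is assumed only at points of [X]. *)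
Lemma closure_image_at (S T : topologicalType) (f : S -> T) (A : set S)
    (B : set T) (p : S) :
  f @ p --> f p -> (forall q, A q -> B (f q)) -> closure A p -> closure B (f p).
Proof.
by move=> cf AB cA N /cf /cA[q [Aq Nq]]; exists (f q); split=> //; exact: AB.
Qed.

Lemma cvg_pair_at (S T U : topologicalType) (F : set_system S) (FF : Filter F)
    (f : S -> T) (h : S -> U) (a : T) (b : U) :
  f @ F --> a -> h @ F --> b -> (fun z => (f z, h z)) @ F --> (a, b).
Proof. by move=> fa hb; exact: cvg_pair. Qed.

Lemma cvg_at_ball (K : numFieldType) (U W : normedModType K) (h : U -> W)
    (x : U) (b : W) (e : K) :
  h y @[y --> x] --> b -> 0 < e ->
  exists2 d : K, 0 < d & forall y, `|y - x| < d -> `|h y - b| < e.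
Proof.
move=> hb e0; have /(_ e e0) hN :=
  (@cvgrPdist_lt _ _ _ (nbhs x) (nbhs_filter x) h b).1 hb.
have [d d0 hd] := (@nbhs_ballP K U x _).1 hN; exists d => // y yx.
by rewrite distrC; apply: hd; rewrite -ball_normE /= distrC.
Qed.

Lemma closure_pairP (K : numFieldType) (U W : normedModType K)
    (A : set (U * W)) p :
  closure A p <-> forall e : K, 0 < e ->
    exists q, [/\ A q, `|q.1 - p.1| < e & `|q.2 - p.2| < e].
Proof.
split=> [cA e e0|h N /nbhs_ballP[e e0 eN]].
  have /cA[q [Aq [q1 q2]]] : nbhs p (ball p e) by exact: nbhsx_ballx.
  by exists q; split=> //; rewrite distrC;
    [move: q1|move: q2]; rewrite -ball_normE.
have [q [Aq q1 q2]] := h e e0; exists q; split=> //; apply: eN.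
by split; rewrite -ball_normE /= distrC.
Qed.

End Closures.

(** * Conormal spaces *)

Section Conormal.
Variables (R : realType) (m : nat).
Local Notation C := (Cplx R).
Local Notation V := ('rV[C]_m).
Local Notation P := (Pspace R m).
Variable X : set V.

Definition smooth_conormal : set (V * V) :=
  [set p | smooth_point X p.1 /\
           forall v, tangent X p.1 v -> pairing p.2 v = 0].

Lemma tangentB y u v (c : C) :
  tangent X y u -> tangent X y v -> tangent X y (u - c *: v).
Proof.
move=> tu tv f af fX.
by rewrite pairingBr pairingZr (tu f af fX) (tv f af fX) mulr0 subr0.
Qed.

Lemma smooth_conormalZ y w (s : C) :
  smooth_conormal (y, w) -> smooth_conormal (y, s *: w).
Proof.
by move=> [sy h]; split=> // v /h; rewrite pairingZl => ->; rewrite mulr0.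
Qed.

Lemma smooth_conormal_sub : smooth_conormal `<=` conormal X.
Proof. by move=> p Sp; split; [exact: Sp.1.1|exact: subset_closure]. Qed.

Lemma conormal_closed x w :
  X x -> closure (conormal X) (x, w) -> conormal X (x, w).
Proof.
move=> Xx h; split=> //.
have /closure_id -> := @closed_closure _ smooth_conormal.
by move: h; apply: closure_subset => p [].
Qed.

Lemma conormalP x w :
  conormal X (x, w) <-> X x /\ closure smooth_conormal (x, w).
Proof. by []. Qed.

Lemma conormalZ x w (s : C) : conormal X (x, w) -> conormal X (x, s *: w).
Proof.
move=> /conormalP[Xx h]; apply/conormalP; split; first by [].
pose F (p : V * V) := (p.1, s *: p.2).
have cF : F @ (x, w) --> (x, s *: w).
  by apply: cvg_pair_at; [exact: cvg_fst|apply: cvgZr; exact: cvg_snd].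
apply: (closure_image_at cF _ h) => -[y w'] h'; exact: smooth_conormalZ.
Qed.

Section relative.
Variable ft : V -> C.
Local Notation g := (grad ft).
Hypothesis cg : forall x, X x -> g y @[y --> x] --> g x.
Hypothesis dX : forall x, X x -> closure (smooth_point X) x.

Definition smooth_relative_conormal : set (V * V) :=
  [set p | smooth_point X p.1 /\
           forall v, tangent X p.1 v ->
             pairing (g p.1) v = 0 -> pairing p.2 v = 0].

Lemma conormal0 x : X x -> conormal X (x, 0).
Proof.
move=> Xx; apply/conormalP; split; first by [].
pose F (y : V) := (y, 0 : V).
have cF : F @ x --> (x, 0 : V).
  by apply: (@cvg_pair_at _ _ _ (nbhs x) (nbhs_filter x));
    [exact: cvg_id|exact: cvg_cst].
apply: (closure_image_at cF _ (dX Xx)) => y sy; split=> //= v _.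
by rewrite -(scale0r (0 : V)) pairingZl mul0r.
Qed.

Lemma relative_conormalP x w : relative_conormal X ft (x, w) <->
  X x /\ closure smooth_relative_conormal (x, w).
Proof. by []. Qed.

Lemma relative_conormal_closed x w : X x ->
  closure (relative_conormal X ft) (x, w) -> relative_conormal X ft (x, w).
Proof.
move=> Xx h; split=> //.
have /closure_id -> := @closed_closure _ smooth_relative_conormal.
by move: h; apply: closure_subset => p [].
Qed.

Lemma relative_conormalZ x w (s : C) :
  relative_conormal X ft (x, w) -> relative_conormal X ft (x, s *: w).
Proof.
move=> /relative_conormalP[Xx h]; apply/relative_conormalP; split; first by [].
pose F (p : V * V) := (p.1, s *: p.2).
have cF : F @ (x, w) --> (x, s *: w).
  by apply: cvg_pair_at; [exact: cvg_fst|apply: cvgZr; exact: cvg_snd].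
apply: (closure_image_at cF _ h) => -[y w'] [sy k]; split=> //= v tv gv.
by rewrite pairingZl k// mulr0.
Qed.

(** The inclusion is clear at smooth points and extends to limits by continuity of the gradient at
    [x]. *)
Lemma conormal_relative x w (s t : C) : conormal X (x, w) ->
  relative_conormal X ft (x, s *: g x + t *: w).
Proof.
move=> /conormalP[Xx h]; apply/relative_conormalP; split; first by [].
pose F (p : V * V) := (p.1, s *: g p.1 + t *: p.2).
have cF : F @ (x, w) --> (x, s *: g x + t *: w).
  apply: cvg_pair_at; first exact: cvg_fst.
  apply: cvgD; apply: cvgZr; last exact: cvg_snd.
  by apply: (cvg_comp _ _ _ (cg Xx)); exact: cvg_fst.
apply: (closure_image_at cF _ h) => -[y w'] [sy k]; split=> //= v tv gv.
by rewrite pairingDl !pairingZl k// gv !mulr0 addr0.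
Qed.

(** If the differential is nonzero on some tangent [v], every tangent vector is a multiple of [v]
    plus a vector of the kernel, and [t] is the ratio of the values at [v]. Otherwise the kernel is
    the whole tangent space and [t = 0] works. *)
Lemma smooth_relative_conormal_split y w : smooth_relative_conormal (y, w) ->
  exists t : C, smooth_conormal (y, w - t *: g y).
Proof.
move=> [sy h]; rewrite /= in sy h.
have [[v tv gv]|nv] :=
  pselect (exists2 v, tangent X y v & pairing (g y) v != 0).
  exists (pairing w v / pairing (g y) v); split=> //= u tu.
  rewrite pairingBl pairingZl.
  have tu' := tangentB (pairing (g y) u / pairing (g y) v) tu tv.
  have := h _ tu'; rewrite !pairingBr !pairingZr divfK// subrr => /(_ erefl) <-.
  by ring.
exists 0; split=> //= u tu; rewrite scale0r subr0 h//.
by apply: contrapT => /eqP gu; apply: nv; exists u.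
Qed.

Lemma pclass_surj (a : P) : exists v, is_pclass v a.
Proof. by exists (val (repr a)), (repr a); split=> //; exact: reprK. Qed.

(** Points of the divisor are limits of directions of [w' - g y] with [(y, w')] conormal. Such
    differences are relative conormal, and the relative conormal space is closed over [X]. *)
Lemma E_div_relative x (a : P) :
  fiber (@proj_out R m @` E_div X ft) x a ->
  fiber (proj_relative_conormal X ft) x a.
Proof.
move=> [[[y w] b] [[/= Xyw cl] _] [yx ba]].
rewrite {}yx {}ba {y b} in Xyw cl *.
have [v va] := pclass_surj a; exists v; last exact: va.
have Xx := Xyw.1; apply: (relative_conormal_closed Xx).
apply/closure_pairP => e e0.
have nV : nbhs v (ball v e) by exact: nbhsx_ballx.
have nxw : nbhs (x, w) (ball (x, w) e) by exact: nbhsx_ballx.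
(* Openness of the quotient map allows nearby directions to be represented by vectors near [v]. *)
pose Q : set P := [set b | exists2 v', ball v e v' & is_pclass v' b].
have : nbhs ((x, w), a) (ball (x, w) e `*` Q).
  by exists (ball (x, w) e, Q) => //; split=> //=; exact: pclass_open nV.
move=> /cl[[[y w'] b] [[/= cy pb] [[/= yx _] [v' vv' v'b]]]].
exists (y, v'); split => /=.
- have [c c0 ->] := is_pclass_prop v'b pb.
  apply: relative_conormalZ.
  by have := conormal_relative (-1) 1 cy; rewrite scaleN1r scale1r addrC.
- by move: yx; rewrite -ball_normE /= distrC.
- by move: vv'; rewrite -ball_normE /= distrC.
Qed.

(** A criterion for membership in the divisor: the scalar [c] turns convergence of directions into
    convergence of vectors. *)
Lemma E_div_intro x (v : V) (a : P) : X x -> is_pclass v a ->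
  (forall e : C, 0 < e -> exists y w (c : C),
     [/\ conormal X (y, w), `|y - x| < e, `|w - g x| < e, c != 0 &
         `|c *: (w - g y) - v| < e]) ->
  fiber (@proj_out R m @` E_div X ft) x a.
Proof.
move=> Xx va h.
have v0 : 0 < `|v| by rewrite normr_gt0 (is_pclass_neq0 va).
exists ((x, g x), a); last by [].
split; last by rewrite /mkset subrr.
have cx : conormal X (x, g x).
  apply: (conormal_closed Xx); apply/closure_pairP => e e0.
  by have [y [w [c [cy yx wx _ _]]]] := h e e0; exists (y, w).
split; first exact: cx.
move=> N [[N1 N2] [/= n1 n2] sN].
have {}n1 : nbhs ((x, g x) : V * V) N1 := n1.
have /nbhs_ballP[e1 /= e10 he1] := n1.
have /nbhs_ballP[e2 /= e20 he2] := nbhs_pclass va n2.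
have [e3 [e30 e31 e32]] := pos_min2 e10 e20.
(* Taking [e] at most [|v|] forces [c *: (w - g y)] to be nonzero, so that it has a class. *)
have [e [e0 ee3 ev]] := pos_min2 e30 v0.
have [y [w [c [cy yx wx c0 cv]]]] := h e e0.
have cw0 : c *: (w - g y) != 0.
  apply/eqP => cw; move: cv; rewrite cw sub0r normrN => /lt_le_trans/(_ ev).
  by rewrite ltxx.
have [b cwb] := is_pclass_ex cw0.
have wb : is_pclass (w - g y) b.
  by have := is_pclassZ (invr_neq0 c0) cwb; rewrite scalerA mulVf// scale1r.
exists ((y, w), b); split=> //; apply: sN; split=> /=.
  apply: he1; split; rewrite -ball_normE /= distrC.
    exact: lt_le_trans yx (le_trans ee3 e31).
  exact: lt_le_trans wx (le_trans ee3 e31).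
apply: he2 cwb; rewrite -ball_normE /= distrC.
exact: lt_le_trans cv (le_trans ee3 e32).
Qed.

(** The base point stays at [x]: the difference [s *: v] has constant direction while [g x + s *: v]
    tends to [g x]. *)
Lemma E_div_line x (v : V) (a : P) : X x -> is_pclass v a ->
  (forall s : C, 0 < s -> conormal X (x, g x + s *: v)) ->
  fiber (@proj_out R m @` E_div X ft) x a.
Proof.
move=> Xx va h; apply: (E_div_intro Xx va) => e e0.
have v1 : 0 < `|v| + 1 by rewrite ltr_wpDl.
pose s := e / 2 / (`|v| + 1); have s0 : 0 < s by rewrite !divr_gt0.
exists x, (g x + s *: v), s^-1.
have s1 : s != 0 by rewrite gt_eqF.
have gK : g x + s *: v - g x = s *: v by rewrite [g x + _]addrC addrK.
rewrite gK scalerA mulVf// scale1r !subrr !normr0.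
split; [exact: h|exact: e0| |by rewrite invr_neq0|exact: e0].
rewrite normrZ (gtr0_norm s0) (@le_lt_trans _ _ (e / 2))//.
  by rewrite /s mulrAC ler_pdivrMr// ler_wpM2l ?lerDl// divr_ge0// ltW.
by rewrite ltr_pdivrMr// mulrDr mulr1 ltrDl.
Qed.

End relative.
End Conormal.

(** * Limits of relative conormal covectors *)

Section Limits.
Variables (R : realType) (m : nat).
Local Notation C := (Cplx R).
Local Notation V := ('rV[C]_m).
Variables (X : set V) (ft : V -> C).
Local Notation g := (grad ft).
Hypothesis cg : forall x, X x -> g y @[y --> x] --> g x.

(** Compactness of a disc of coefficients replaces the extraction of a subsequence: if no [t] in the
    disc gives a conormal limit, then none splits the covectors near [(x, w)]. *)
Lemma relative_conormal_limit x w : relative_conormal X ft (x, w) ->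
  (forall e M : C, 0 < e -> 0 <= M -> exists y w' (t : C),
     [/\ smooth_conormal X (y, w' - t *: g y), `|y - x| < e, `|w' - w| < e &
         M < `|t|]) \/
  exists t : C, conormal X (x, w - t *: g x).
Proof.
move=> [/= Xx cl]; set Unb := (X in X \/ _).
have [?|nU] := pselect Unb; first by left.
right; apply: contrapT => nt.
(* Denying the first alternative bounds the coefficients of all splittings near [(x, w)]. *)
have [e [M [e0 M0 eM]]] : exists e M : C, [/\ 0 < e, 0 <= M &
    forall y w' (t : C), `|y - x| < e -> `|w' - w| < e ->
      smooth_conormal X (y, w' - t *: g y) -> `|t| <= M].
  apply: contrapT => h; apply: nU => e M e0 M0.
  apply: contrapT => h'; apply: h; exists e, M; split=> // y w' t yx ww' sy.
  have [//|Mt] := real_leP (normr_real t) (ger0_real M0).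
  by exfalso; apply: h'; exists y, w', t.
pose Q (p : V * V) (t : C) := ~ smooth_conormal X (p.1, p.2 - t *: g p.1).
have cov : forall t : C, [set t | `|t| <= M] t ->
    \forall t' \near t & p \near (x, w), Q p t'.
  move=> t _; have ncl : ~ closure (smooth_conormal X) (x, w - t *: g x).
    by move=> h; apply: nt; exists t.
  have [N nN SN] : exists2 N, nbhs (x, w - t *: g x) N &
      forall q, N q -> ~ smooth_conormal X q.
    apply: contrapT => h; apply: ncl => N nN; apply: contrapT => h'; apply: h.
    by exists N => // q Nq Sq; apply: h'; exists q.
  pose G (z : C * (V * V)) := (z.2.1, z.2.2 - z.1 *: g z.2.1).
  have c1 : (fun z : C * (V * V) => z.2.1) @ (t, (x, w)) --> x.
    by apply: (cvg_comp _ _ cvg_snd); exact: cvg_fst.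
  have cG : G @ (t, (x, w)) --> (x, w - t *: g x).
    apply: cvg_pair_at; first exact: c1.
    have c2 : (fun z : C * (V * V) => z.2.2) @ (t, (x, w)) --> w.
      by apply: (cvg_comp _ _ cvg_snd); exact: cvg_snd.
    have c3 : (fun z : C * (V * V) => z.1) @ (t, (x, w)) --> t.
      exact: cvg_fst.
    have c4 : (fun z : C * (V * V) => g z.2.1) @ (t, (x, w)) --> g x.
      exact: (cvg_comp _ _ c1 (cg Xx)).
    have c5 : (fun z : C * (V * V) => z.1 *: g z.2.1) @ (t, (x, w)) -->
        t *: g x.
      by apply: cvgZ.
    exact: (cvgB c2 c5).
  have nGN : nbhs (t, (x, w)) (G @^-1` N) by exact: cG.
  suff : nbhs (t, (x, w)) (fun z => Q z.2 z.1) by [].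
  by apply: filterS nGN => z Nz; exact: SN _ Nz.
(* A single neighborhood of [(x, w)] now serves for all [t] in the disc. *)
have near_all := (compact_near_coveringP _).1 (@closed_disc_compact R M) _ _ Q
  (nbhs_filter (x, w)) cov.
have nb : nbhs (x, w) (ball (x, w) e) by exact: nbhsx_ballx.
have [[y w'] [Sp [Qp [/= byx bww]]]] := cl _ (filterI near_all nb).
have [t St] := smooth_relative_conormal_split Sp.
apply: (Qp t _ St); apply: (eM y w' t _ _ St).
  by rewrite distrC; move: byx; rewrite -ball_normE.
by rewrite distrC; move: bww; rewrite -ball_normE.
Qed.

(** The conormal covector [g y - t^-1 *: w'] tends to [g x], and [- t] times its difference with
    [g y] is exactly [w']. *)
Lemma unbounded_E_div x (w : V) (a : Pspace R m) : X x -> is_pclass w a ->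
  (forall e M : C, 0 < e -> 0 <= M -> exists y w' (t : C),
     [/\ smooth_conormal X (y, w' - t *: g y), `|y - x| < e, `|w' - w| < e &
         M < `|t|]) ->
  fiber (@proj_out R m @` E_div X ft) x a.
Proof.
move=> Xx wa h; apply: (E_div_intro Xx wa) => e e0.
have e20 : 0 < e / 2 by rewrite divr_gt0.
have [d d0 hd] := cvg_at_ball (cg Xx) e20.
have [e' [e'0 e'e e'd]] := pos_min2 e0 d0.
(* Since [|w'| <= |w| + e], a coefficient beyond [M] makes [t^-1 *: w'] smaller than [e / 2]. *)
pose M := (`|w| + e) / (e / 2).
have M0 : 0 <= M by rewrite divr_ge0 ?addr_ge0// ltW.
have [y [w' [t [Sy yx ww Mt]]]] := h _ _ e'0 M0.
have t0 : t != 0 by rewrite -normr_gt0 (le_lt_trans M0).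
exists y, (g y - t^-1 *: w'), (- t).
have E : (- t) *: (g y - t^-1 *: w' - g y) = w'.
  by rewrite addrAC subrr add0r scalerN scaleNr opprK scalerA mulfV// scale1r.
split; rewrite ?oppr_eq0//.
- apply: smooth_conormal_sub.
  have := smooth_conormalZ (- t^-1) Sy.
  by rewrite scalerBr scalerA mulNr mulVf// !scaleNr scale1r opprK addrC.
- exact: lt_le_trans yx e'e.
- rewrite addrAC (le_lt_trans (ler_normB _ _))// [ltRHS](splitr e) ltr_leD//.
    by apply: hd; exact: lt_le_trans yx e'd.
  rewrite normrZ normfV ler_pdivrMl ?normr_gt0// -ler_pdivrMr//.
  apply: le_trans (ltW Mt); rewrite /M ler_wpM2r ?invr_ge0 ?(ltW e20)//.
  rewrite -(subrK w w') addrC (le_trans (ler_normD _ _))// lerD2l.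
  exact: le_trans (ltW ww) e'e.
- by rewrite E (lt_le_trans ww).
Qed.

End Limits.

(** * Functions in the square of the maximal ideal *)

Section MaximalIdealSquare.
Variables (R : realType) (m : nat).
Local Notation C := (Cplx R).
Local Notation V := ('rV[C]_m).

(** Both factors vanish at [x], so on the ball of radius [r] they are of order [r], and the Leibniz
    splitting gives a Lipschitz constant of order [r]. *)
Lemma product_small_lipschitz (a b : V -> C) (x : V) (e : C) :
  analytic_at a x -> analytic_at b x -> a x = 0 -> b x = 0 -> 0 < e ->
  exists2 r : C, 0 < r & forall z z', `|z - x| < r -> `|z' - x| < r ->
    `|a z * b z - a z' * b z'| <= e * `|z - z'|.
Proof.
move=> /analytic_strict_differential[La /strict_differential_lipschitz
  [ca ca0 [da da0 ha]]].
move=> /analytic_strict_differential[Lb /strict_differential_lipschitz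
  [cb cb0 [db db0 hb]]].
move=> a0 b0 e0.
have [d [d0 dda ddb]] := pos_min2 da0 db0.
have [r [r0 rd re]] : exists r : C, [/\ 0 < r, r <= d & r <= e / (2 * ca * cb)].
  by apply: pos_min2; rewrite // divr_gt0 ?mulr_gt0.
exists r => // z z' zx z'x.
have ltr_ (y : V) : `|y - x| < r -> `|y - x| < da /\ `|y - x| < db.
  by move=> yr; split; apply: (lt_le_trans yr); rewrite (le_trans rd).
have [za zb] := ltr_ _ zx; have [za' zb'] := ltr_ _ z'x.
have xa : `|x - x| < da by rewrite subrr normr0.
have xb : `|x - x| < db by rewrite subrr normr0.
have az : `|a z| <= ca * r.
  have := ha _ _ za xa; rewrite a0 subr0 => /le_trans; apply.
  by rewrite ler_pM2l// ltW.
have bz' : `|b z'| <= cb * r.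
  have := hb _ _ zb' xb; rewrite b0 subr0 => /le_trans; apply.
  by rewrite ler_pM2l// ltW.
have -> : a z * b z - a z' * b z' = a z * (b z - b z') + b z' * (a z - a z').
  by ring.
rewrite (le_trans (ler_normD _ _))// !normrM.
rewrite (le_trans (lerD (ler_pM _ _ az (hb _ _ zb zb'))
  (ler_pM _ _ bz' (ha _ _ za za'))))//.
have -> : ca * r * (cb * `|z - z'|) + cb * r * (ca * `|z - z'|) =
  r * (2 * ca * cb) * `|z - z'| by ring.
by rewrite ler_wpM2r// -ler_pdivlMr ?mulr_gt0.
Qed.

Variables (X : set V) (f ft : V -> C).
Local Notation g := (grad ft).

Lemma max_ideal_sq_lipschitz (x : V) (e : C) :
  (forall z, X z -> ft z = f z) ->
  in_max_ideal_sq X x (fun y => f y - f x) -> 0 < e ->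
  exists2 r : C, 0 < r &
    forall z z', X z -> X z' -> `|z - x| < r -> `|z' - x| < r ->
      `|ft z - ft z'| <= e * `|z - z'|.
Proof.
move=> ext [k [a [b [hab /nbhs_ballP[d /= d0 hd]]]]] e0.
have k1 : 0 < k%:R + 1 :> C by rewrite ltr_wpDl.
have ek : 0 < e / (k%:R + 1) by rewrite divr_gt0.
have /choice[rr hr] : forall i, exists r : C, 0 < r /\
    forall z z', `|z - x| < r -> `|z' - x| < r ->
    `|a i z * b i z - a i z' * b i z'| <= e / (k%:R + 1) * `|z - z'|.
  move=> i; have [aa ab a0 b0] := hab i.
  by have [r ? ?] := product_small_lipschitz aa ab a0 b0 ek; exists r.
have [r1 r10 r1le] := pos_min_ord (fun i => (hr i).1).
have [r [r0 rr1 rd]] := pos_min2 r10 d0.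
exists r => // z z' Xz Xz' zx z'x.
have fz y : X y -> `|y - x| < r -> ft y = f x + \sum_i a i y * b i y.
  move=> Xy yx; rewrite ext// -(hd y _ Xy) ?[f x + _]addrC ?subrK//.
  by rewrite -ball_normE /= distrC (lt_le_trans yx).
rewrite !fz// opprD addrACA subrr add0r -sumrB.
rewrite (le_trans (ler_norm_sum _ _ _))//.
rewrite (@le_trans _ _ (\sum_(i < k) e / (k%:R + 1) * `|z - z'|))//.
  apply: ler_sum => i _; apply: (hr i).2.
    exact: lt_le_trans zx (le_trans rr1 (r1le i)).
  exact: lt_le_trans z'x (le_trans rr1 (r1le i)).
rewrite sumr_const card_ord -[leLHS]mulr_natl mulrA ler_wpM2r//.
by rewrite mulrCA ler_piMr ?(ltW e0)// ler_pdivrMr// mul1r lerDl.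
Qed.

(** At smooth [y] near [x] the small Lipschitz constant of [ft] on [X] puts [g y] within a small [D]
    of a conormal covector; adding [s *: (g y - D)] to a conormal [w'] near [w] approximates the
    target. *)
Lemma conormal_shift (x w : V) (s : C) :
  (forall x, X x -> g y @[y --> x] --> g x) ->
  (forall x, X x -> analytic_at ft x) ->
  (forall z, X z -> ft z = f z) ->
  in_max_ideal_sq X x (fun y => f y - f x) ->
  conormal X (x, w) -> conormal X (x, w + s *: g x).
Proof.
move=> cg aft ext m2 /conormalP[Xx cl]; apply/conormalP; split; first by [].
apply/closure_pairP => e e0.
(* The errors [|g y - g x|] and [|D|] are each at most [e1]; scaled by [s] they total at most
   [e / 2]. *)
have s1 : 0 < `|s| + 1 by rewrite ltr_wpDl.
pose e1 := e / 4 / (`|s| + 1); have e10 : 0 < e1 by rewrite !divr_gt0.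
have [r r0 hr] := max_ideal_sq_lipschitz ext m2 e10.
have [d d0 hd] := cvg_at_ball (cg _ Xx) e10.
have e20 : 0 < e / 2 by rewrite divr_gt0.
(* The bound [r / 2] puts the ball of radius [r / 2] around [y] inside the ball of radius [r] around
   [x]. *)
have [d1 [d10 d1r d1d]] : exists d1 : C, [/\ 0 < d1, d1 <= r / 2 & d1 <= d].
  by apply: pos_min2; rewrite ?divr_gt0.
have [d2 [d20 d2d d2e]] := pos_min2 d10 e20.
have [[y w'] [Sy /= yx ww]] := (closure_pairP _ _).1 cl _ d20.
have [sy kw] := Sy; rewrite /= in sy kw.
have Xy := sy.1.
have yr2 : `|y - x| < r / 2 by rewrite (lt_le_trans yx)// (le_trans d2d).
have r2r : r / 2 < r by rewrite ltr_pdivrMr// mulrDr mulr1 ltrDl.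
have r20 : 0 < r / 2 by rewrite divr_gt0.
have hF z : X z -> `|z - y| < r / 2 -> `|ft z - ft y| <= e1 * `|z - y|.
  move=> Xz zy; apply: hr => //; last exact: lt_trans yr2 r2r.
  rewrite -(subrK y z) -addrA (le_lt_trans (ler_normD _ _))// [ltRHS](splitr r).
  exact: ltrD.
have [D De kD] := almost_conormal sy
  (analytic_strict_differential_grad (aft _ Xy))
  (ltW e10) r20 hF.
exists (y, w' + s *: (g y - D)); split => /=.
- split=> //= v tv.
  by rewrite pairingDl pairingZl kw// kD// mulr0 addr0.
- rewrite (lt_le_trans yx)// (le_trans d2e)// ler_pdivrMr// mulrDr mulr1.
  by rewrite lerDl ltW.
rewrite opprD addrACA -scalerBr (le_lt_trans (ler_normD _ _))//.
rewrite [ltRHS](splitr e) ltr_leD// ?(lt_le_trans ww)//.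
rewrite normrZ addrAC (le_trans (ler_wpM2l _ (ler_normB _ _)))//.
have gyx : `|g y - g x| <= e1.
  by rewrite ltW//; apply: hd; rewrite (lt_le_trans yx)// (le_trans d2d).
rewrite (le_trans (ler_wpM2l _ (lerD gyx De)))//.
rewrite (@le_trans _ _ ((`|s| + 1) * (e1 + e1)))//.
  by rewrite ler_wpM2r ?lerDl// addr_ge0// ltW.
by rewrite /e1 le_eqVlt; apply/orP; left; apply/eqP; field; rewrite gt_eqF.
Qed.

End MaximalIdealSquare.

(** * The fibers of the relative conormal space *)

Section FiberEquality.
Variables (R : realType) (m : nat).
Local Notation C := (Cplx R).
Local Notation V := ('rV[C]_m).
Local Notation P := (Pspace R m).
Variables (X : set V) (f ft : V -> C).
Local Notation g := (grad ft).
Hypothesis cg : forall x, X x -> g y @[y --> x] --> g x.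
Hypothesis dX : forall x, X x -> closure (smooth_point X) x.
Hypothesis aft : forall x, X x -> analytic_at ft x.
Hypothesis ext : forall x, X x -> ft x = f x.

Lemma pclass_scalar_eq (u v : V) (a b : P) (c : C) :
  is_pclass u a -> is_pclass v b -> u = c *: v -> a = b.
Proof.
move=> ua vb uv; have c0 : c != 0.
  by apply: contra_neq (is_pclass_neq0 ua) => c0; rewrite uv c0 scale0r.
have := is_pclassZ c0 vb; rewrite -uv => ub; exact: is_pclass_uniq ua ub.
Qed.

Lemma is_pclass_conormal x (v : V) (b : P) : is_pclass v b ->
  fiber (proj_conormal X) x b -> conormal X (x, v).
Proof.
move=> vb [w cw wb]; have [c _ ->] := is_pclass_prop vb wb.
exact: (conormalZ c cw).
Qed.

Lemma pline_relative x (a b c : P) (w : V) : X x -> is_pclass (g x) a ->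
  fiber (proj_conormal X) x b -> pline a b c -> is_pclass w c ->
  relative_conormal X ft (x, w).
Proof.
move=> Xx ga Wb [u [v [w' [ua vb w'c [s [t w'E]]]]]] wc.
have [k _ ->] := is_pclass_prop wc w'c.
apply: relative_conormalZ; rewrite w'E.
have [l _ ->] := is_pclass_prop ua ga; rewrite scalerA.
exact: (conormal_relative cg _ _ (is_pclass_conormal vb Wb)).
Qed.

(** Lines are handled by [pline_relative], limits of lines by closedness, and the vertex by the zero
    covector, which is conormal at [x] because smooth points are dense. *)
Lemma join_relative x (a c : P) : X x -> is_pclass (g x) a ->
  join a (fiber (proj_conormal X) x) c ->
  fiber (proj_relative_conormal X ft) x c.
Proof.
move=> Xx ga [[_ cl]|[_ [->|[b Wb abc]]]].
- have [v vc] := pclass_surj c; exists v; last exact: vc.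
  apply: (relative_conormal_closed Xx); apply/closure_pairP => e e0.
  have nv : nbhs v (ball v e) by exact: nbhsx_ballx.
  have [c' [[b [Wb _] abc] [v' vv' v'c']]] := cl _ (pclass_open vc nv).
  exists (x, v'); split; first exact: pline_relative Xx ga Wb abc v'c'.
    by rewrite subrr normr0.
  by rewrite distrC; move: vv'; rewrite -ball_normE.
- exists (g x); last exact: ga.
  have := conormal_relative cg 1 0 (conormal0 dX Xx).
  by rewrite scale1r scaler0 addr0.
- have [v vc] := pclass_surj c; exists v; last exact: vc.
  exact: pline_relative Xx ga Wb abc vc.
Qed.

Lemma conormal_join x (w : V) (a : P) (t : C) : X x -> is_pclass w a ->
  conormal X (x, w - t *: g x) ->
  fiber (@proj_out R m @` E_div X ft) x a \/ join_term X f ft x a.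
Proof.
move=> Xx wa cw.
(* If [w] is a multiple of a conormal [g x], the whole line [g x + r *: w] is conormal. *)
have gE (s : C) : conormal X (x, g x) -> w = s *: g x ->
    fiber (@proj_out R m @` E_div X ft) x a.
  move=> cgx ws; apply: (E_div_line Xx wa) => r _; rewrite ws scalerA.
  by rewrite -{1}[g x]scale1r -scalerDl; exact: conormalZ.
have [g0|gn0] := eqVneq (g x) 0.
  left; apply: (E_div_line Xx wa) => r _; rewrite g0 add0r.
  by apply: conormalZ; move: cw; rewrite g0 scaler0 subr0.
have [m2|nm2] := pselect (in_max_ideal_sq X x (fun y => f y - f x)).
  (* The shift by [r * t + 1] turns [r *: (w - t *: g x)] into [g x + r *: w]. *)
  left; apply: (E_div_line Xx wa) => r _.
  have := conormal_shift (r * t + 1) cg aft ext m2 (conormalZ r cw).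
  by rewrite scalerBr scalerA scalerDl scale1r addrA subrK addrC.
have [b gb] := is_pclass_ex gn0.
set W := fiber (proj_conormal X) x.
have [ab|ab] := pselect (a = b).
  rewrite {}ab {a} in wa gE *.
  have [Wb|nWb] := pselect (W b).
    have [s _ ws] := is_pclass_prop wa gb.
    by left; apply: (gE s _ ws); exact: is_pclass_conormal gb Wb.
  right; split; first exact: nm2.
  (* Here the point is the vertex of the join, which lies outside the conormal fiber. *)
  by exists b; [exact: gb|right; split; [exact: nWb|left]].
have w'0 : w - t *: g x != 0.
  rewrite subr_eq0; apply/eqP => ws; apply: ab.
  exact: pclass_scalar_eq wa gb ws.
have [c w'c] := is_pclass_ex w'0.
have Wc : W c by exists (w - t *: g x); [exact: cw|exact: w'c].
have bca : pline b c a.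
  exists (g x), (w - t *: g x), w; split; [exact: gb|exact: w'c|exact: wa|].
  exists t, 1.
  by rewrite scale1r addrC subrK.
right; split; first exact: nm2.
exists b; first exact: gb.
have [Wb|nWb] := pselect (W b).
  left; split; first exact: Wb.
  apply: subset_closure; exists c; last exact: bca.
  split; first exact: Wc.
  (* The join removes its vertex from the fiber; [c] is not the vertex, since otherwise [w] would be
     a multiple of [g x]. *)
  move=> cb; apply: ab; rewrite cb in w'c.
  have [s _ ws] := is_pclass_prop w'c gb.
  apply: (@pclass_scalar_eq _ _ _ _ (s + t) wa gb).
  by rewrite scalerDl -ws subrK.
by right; split; [exact: nWb|right; exists c; [exact: Wc|exact: bca]].
Qed.

Lemma fiber_relative_conormal x : X x ->
  fiber (proj_relative_conormal X ft) x =
  fiber (@proj_out R m @` E_div X ft) x `|` join_term X f ft x.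
Proof.
move=> Xx; apply/seteqP; split=> a.
  move=> [w rw wa].
  have [h|[t cw]] := relative_conormal_limit cg rw.
    by left; exact: unbounded_E_div Xx wa h.
  exact: conormal_join Xx wa cw.
move=> [Ea|[_ [b gb ja]]]; first exact: E_div_relative.
exact: join_relative Xx gb ja.
Qed.

End FiberEquality.

Theorem theorem2p2 (R : realType) (m : nat) (U X : set 'rV[Cplx R]_m)
    (f ft : 'rV[Cplx R]_m -> Cplx R)
    (openU : open U)
    (X0 : X 0)
    (anX : analytic_subset U X)
    (anf : analytic_on_set X f)
    (subm : generic_submersion U X ft)
    (anft : forall p, U p -> analytic_at ft p)
    (ext : forall x, X x -> ft x = f x) :
  forall x, X x ->
    fiber (proj_relative_conormal X ft) x =
    fiber (@proj_out R m @` E_div X ft) x `|` join_term X f ft x.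
Proof.
move=> x Xx; have XU := anX.1.
apply: fiber_relative_conormal => // {x Xx} x Xx; last exact/anft/XU.
(* The gradient is continuous at [x] because [ft] is strictly differentiable at every point of the
   open set [U]. *)
- apply/(@cvgrPdist_le _ _ _ (nbhs x) (nbhs_filter x)) => e e0.
  have [d d0 hd] := strict_differential_continuous e0
    (analytic_strict_differential_grad (anft x (XU x Xx))).
  have nU : nbhs x U by apply: open_nbhs_nbhs; split=> //; exact: XU.
  have nb : nbhs x (ball x d) by exact: nbhsx_ballx.
  apply: filterS (filterI nU nb) => y [Uy xy]; rewrite distrC.
  apply: hd (analytic_strict_differential_grad (anft y Uy)).
  by rewrite distrC; move: xy; rewrite -ball_normE.
(* Points of [X] off [Z] are smooth, and they are dense in [X]. *)
- have [Z [_ _ dZ sm]] := subm.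
  by apply: closure_subset (dZ x Xx) => y Xy; exact: (sm y Xy).1.
Qed.
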